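(* Let $n\ge 4$ and let $(p_1,\ldots,p_{n-1})$ be an admissible $(n-1)$-tuple. Suppose that for some $i$ with $2\le i\le n-2$, both $p_{i-1}$ and $p_{i+1}$ are even. If $\mathcal{P}(p_1,\ldots,p_i)$ is a tight orientably-regular polytope of type $\{p_1,\ldots,p_i\}$ and $\mathcal{P}(p_i,\ldots,p_{n-1})$ is a tight orientably-regular polytope of type $\{p_i,\ldots,p_{n-1}\}$, then $\mathcal{P}(p_1,\ldots,p_{n-1})$ is a tight orientably-regular polytope of type $\{p_1,\ldots,p_{n-1}\}$.
   Context: An $(m-1)$-tuple $(p_1,\ldots,p_{m-1})$ of integers $\ge 2$ is admissible if whenever $p_j$ is odd, each of $p_{j-1}$ and $p_{j+1}$ (when its index lies in $\{1,\ldots,m-1\}$) is an even divisor of $2p_j$. For such a tuple, $\Gamma(p_1,\ldots,p_{m-1})$ is the group generated by $x_0,\ldots,x_{m-1}$ subject to $x_j^2=1$, $(x_{j-1}x_j)^{p_j}=1$ ($1\le j\le m-1$), $(x_jx_k)^2=1$ for $|j-k|\ge 2$, and $r_j=1$ for $1\le j\le m-2$, where $r_j=(x_{j-1}x_jx_{j+1}x_j)^2$ if $p_j,p_{j+1}$ are both even, $r_j=(x_{j-1}x_jx_{j+1}x_jx_{j+1})^2$ if $p_j$ is odd and $p_{j+1}$ even, and $r_j=(x_{j+1}x_jx_{j-1}x_jx_{j-1})^2$ if $p_j$ is even and $p_{j+1}$ odd. $\mathcal{P}(p_1,\ldots,p_{m-1})$ is the poset built from $\Gamma=\Gamma(p_1,\ldots,p_{m-1})$: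 for $0\le j\le m-1$ its $j$-faces are the right cosets of $\Gamma_j=\langle x_k:k\ne j\rangle$, with $\Gamma_j\varphi\le\Gamma_k\psi$ iff $j\le k$ and the cosets intersect, together with a least face of rank $-1$ and a greatest face of rank $m$. An abstract polytope of rank $m$ is a ranked poset (ranks $-1$ to $m$) with unique least and greatest faces, flags of $m+2$ faces, connected sections and the diamond condition; it has type $\{p_1,\ldots,p_{m-1}\}$ if every section between an $(j-2)$-face and an incident $(j+1)$-face is a $p_j$-gon; it is tight if it has exactly $2p_1\cdots p_{m-1}$ flags; it is regular if its automorphism group is flag-transitive (generated by reflections $\rho_0,\ldots,\rho_{m-1}$ relative to a base flag), and orientably-regular if the rotation subgroup $\langle\rho_{j-1}\rho_j\rangle$ has index $2$. *)

(* Defs.v *)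
From HB Require Import structures.
From Stdlib Require Import Relation_Operators.
From mathcomp Require Import all_boot all_order all_algebra generic_quotient.
From mathcomp Require Import boolp classical_sets functions cardinality.

Set Implicit Arguments.
Unset Strict Implicit.
Unset Printing Implicit Defensive.

Import Order.TTheory GRing.Theory Num.Theory.
Local Open Scope classical_set_scope.
Local Open Scope card_scope.
Local Open Scope quotient_scope.

(* The letter (x, true) is the generator x, and (x, false) its formal
   inverse. *)
Definition word (X : Type) := seq (X * bool).

Definition word_gen (X : Type) (x : X) : word X := [:: (x, true)].

Definition word_exp (X : Type) (w : word X) (k : nat) : word X :=
  flatten (nseq k w).

Definition word_inv (X : Type) (w : word X) : word X :=
  rev [seq (a.1, ~~ a.2) | a <- w].

Inductive word_step (X : Type) (R : set (word X)) : word X -> word X -> Prop :=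
| step_cancel u v x b : word_step R (u ++ [:: (x, b); (x, ~~ b)] ++ v) (u ++ v)
| step_relator u v r of R r : word_step R (u ++ r ++ v) (u ++ v).

Definition word_eq (X : Type) (R : set (word X)) : word X -> word X -> Prop :=
  clos_refl_sym_trans (word X) (word_step R).

Section Presented.
Context (X : choiceType) (R : set (word X)).
Implicit Types u v w : word X.

Definition word_eqb : rel (word X) := fun u v => `[< word_eq R u v >].

Fact word_eqb_refl : reflexive word_eqb.
Proof. by move=> u; apply/asboolP; apply: rst_refl. Qed.

Fact word_eqb_sym : symmetric word_eqb.
Proof. by move=> u v; apply/asboolP/asboolP; apply: rst_sym. Qed.

Fact word_eqb_trans : transitive word_eqb.
Proof.
by move=> v u w /asboolP uv /asboolP vw; apply/asboolP; apply: rst_trans uv vw.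
Qed.

Canonical word_equiv :=
  EquivRel word_eqb word_eqb_refl word_eqb_sym word_eqb_trans.

Definition presented : Type := {eq_quot word_equiv}.
HB.instance Definition _ := EqQuotient.copy presented {eq_quot word_equiv}.
HB.instance Definition _ := Choice.copy presented {eq_quot word_equiv}.

Lemma presented_eqP u v :
  \pi_presented u = \pi_presented v <-> word_eq R u v.
Proof.
split; first by move=> /eqmodP /asboolP.
by move=> uv; apply/eqmodP/asboolP.
Qed.

Lemma word_eq_cat u u' v v' :
  word_eq R u u' -> word_eq R v v' -> word_eq R (u ++ v) (u' ++ v').
Proof.
move=> uu' vv'; apply: (@rst_trans _ _ _ (u' ++ v)).
  elim: uu' => {u u' vv' v'} [u u'|u|u u' _|u u' u'' _ IH1 _ IH2].
  - case=> [s t x b|s t r Rr]; apply: rst_step; rewrite -!catA.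
      exact: step_cancel.
    exact: step_relator.
  - exact: rst_refl.
  - exact: rst_sym.
  - exact: rst_trans IH1 IH2.
elim: vv' => {v v' uu' u} [v v'|v|v v' _|v v' v'' _ IH1 _ IH2].
- case=> [s t x b|s t r Rr]; apply: rst_step; rewrite !(catA u').
    exact: step_cancel.
  exact: step_relator.
- exact: rst_refl.
- exact: rst_sym.
- exact: rst_trans IH1 IH2.
Qed.

Lemma word_eq_mulV w : word_eq R (w ++ word_inv w) [::].
Proof.
elim: w => [|[x b] w IH]; first exact: rst_refl.
rewrite /word_inv /= rev_cons -cats1 -/(word_inv w).
have -> : (x, b) :: w ++ word_inv w ++ [:: (x, ~~ b)] =
  [:: (x, b)] ++ (w ++ word_inv w) ++ [:: (x, ~~ b)] by rewrite -catA.
apply: (@rst_trans _ _ _ ([:: (x, b)] ++ [::] ++ [:: (x, ~~ b)])).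
  apply: word_eq_cat; first exact: rst_refl.
  by apply: word_eq_cat => //; exact: rst_refl.
by apply: rst_step; apply: (@step_cancel _ _ [::] [::]).
Qed.

Lemma word_invK : involutive (@word_inv X).
Proof.
move=> w; rewrite /word_inv map_rev revK -map_comp map_id_in //.
by move=> [x b] _ /=; rewrite negbK.
Qed.

Lemma word_eq_Vmul w : word_eq R (word_inv w ++ w) [::].
Proof. by rewrite -[X in _ ++ X]word_invK; apply: word_eq_mulV. Qed.

Definition pres_one : presented := \pi_presented [::].
Definition pres_mul (a b : presented) : presented :=
  \pi_presented (repr a ++ repr b).
Definition pres_inv (a : presented) : presented :=
  \pi_presented (word_inv (repr a)).

Lemma repr_pi_eq w : word_eq R (repr (\pi_presented w)) w.
Proof. by apply/presented_eqP; rewrite reprK. Qed.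

Lemma pres_mul_pi u v :
  pres_mul (\pi_presented u) (\pi_presented v) = \pi_presented (u ++ v).
Proof. by apply/presented_eqP; apply: word_eq_cat; apply: repr_pi_eq. Qed.

Fact pres_mulA : associative pres_mul.
Proof.
move=> a b c; apply/presented_eqP.
apply: (@rst_trans _ _ _ (repr a ++ repr b ++ repr c)).
  by apply: word_eq_cat; [exact: rst_refl | exact: repr_pi_eq].
rewrite catA; apply: word_eq_cat; last exact: rst_refl.
exact/rst_sym/repr_pi_eq.
Qed.

Fact pres_mul1 : left_id pres_one pres_mul.
Proof.
move=> a; rewrite -[RHS]reprK; apply/presented_eqP.
by apply: (@word_eq_cat _ [::] _ (repr a));
  [exact: repr_pi_eq | exact: rst_refl].
Qed.

Fact pres_mulr1 : right_id pres_one pres_mul.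
Proof.
move=> a; rewrite -[RHS]reprK -[repr a in RHS]cats0; apply/presented_eqP.
by apply: word_eq_cat; [exact: rst_refl | exact: repr_pi_eq].
Qed.

Fact pres_mulV : left_inverse pres_one pres_inv pres_mul.
Proof.
move=> a; apply/presented_eqP; apply: rst_trans (word_eq_Vmul (repr a)).
by apply: word_eq_cat; [exact: repr_pi_eq | exact: rst_refl].
Qed.

Fact pres_mulrV : right_inverse pres_one pres_inv pres_mul.
Proof.
move=> a; apply/presented_eqP; apply: rst_trans (word_eq_mulV (repr a)).
by apply: word_eq_cat; [exact: rst_refl | exact: repr_pi_eq].
Qed.

HB.instance Definition _ := isGroup.Build presented
  pres_mulA pres_mul1 pres_mulr1 pres_mulV pres_mulrV.

End Presented.

Section Subgroups.
Context (G : groupType).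
Local Open Scope group_scope.

Definition is_subgroup (H : set G) : Prop :=
  [/\ H 1, (forall x y, H x -> H y -> H (x * y)) & (forall x, H x -> H x^-1)].

Definition generated (A : set G) : set G := smallest is_subgroup A.

Definition right_coset (H : set G) (g : G) : set G := [set h * g | h in H].

Definition right_cosets (H : set G) : set (set G) := range (right_coset H).

Definition has_index (H : set G) (k : nat) : Prop := right_cosets H #= `I_k.

End Subgroups.

(* No axiom is imposed here: that the incidence relation is a partial order
   and that the rank is compatible with it is part of [is_polytope]. *)
Record ranked_rel := RankedRel {
  face :> Type;
  fle : face -> face -> Prop;
  frank : face -> int
}.

Section Polytopes.
Context (P : ranked_rel).
Implicit Types (F G H K : P) (Phi Psi C D : set P).

Definition flt F G : Prop := fle F G /\ F <> G.

Definition is_chain C : Prop := total_on C (@fle P).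

Definition is_flag C : Prop :=
  is_chain C /\ forall D, is_chain D -> C `<=` D -> D = C.

Definition is_section F G : set P := [set H | fle F H /\ fle H G].

Definition section_proper F G : set P := [set H | flt F H /\ flt H G].

Definition section_adj F G H K : Prop :=
  [/\ section_proper F G H, section_proper F G K & fle H K \/ fle K H].

(* A section G/F has rank (rank of G) - (rank of F) - 1; sections of rank at
   most 1 are connected by convention. *)
Definition section_connected F G : Prop :=
  (frank G - frank F - 1 <= 1)%R \/
  forall H K, section_proper F G H -> section_proper F G K ->
    clos_refl_trans P (section_adj F G) H K.

Definition is_poset : Prop :=
  [/\ forall F, fle F F,
      forall F G, fle F G -> fle G F -> F = G
    & forall F G H, fle F G -> fle G H -> fle F H].

Definition is_polytope (m : nat) : Prop :=
  [/\ [/\ is_poset,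
          forall F, (- 1 <= frank F <= m%:Z)%R
        & forall F G, flt F G -> (frank F < frank G)%R],
      (exists! F, forall G, fle F G) /\ (exists! G, forall F, fle F G),
      forall C, is_flag C -> C #= `I_m.+2,
      forall F G, fle F G -> section_connected F G
    & forall F G, fle F G -> frank G = (frank F + 2)%R ->
        section_proper F G #= `I_2].

End Polytopes.

(* The face poset of a convex k-gon (a digon for k = 2): the edge j joins the
   vertices j and j + 1 modulo k. *)
Inductive gon_face (k : nat) :=
| gon_least
| gon_vertex of 'I_k
| gon_edge of 'I_k
| gon_greatest.

Definition gon_le (k : nat) (a b : gon_face k) : bool :=
  match a, b with
  | gon_least, _ | _, gon_greatest => true
  | gon_vertex i, gon_vertex j => i == j
  | gon_edge i, gon_edge j => i == j
  | gon_vertex i, gon_edge j => (i == j) || (i == ordS j)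
  | _, _ => false
  end.

Definition section_is_gon (P : ranked_rel) (k : nat) (F G : P) : Prop :=
  exists f : gon_face k -> P,
    set_bij setT (is_section F G) f /\
    forall a b, fle (f a) (f b) <-> gon_le a b.

(* p_j, for 1 <= j <= size p. *)
Definition entry (p : seq nat) (j : nat) : nat := nth 0 p j.-1.

Definition has_type (P : ranked_rel) (p : seq nat) : Prop :=
  forall j : nat, 1 <= j <= size p ->
  forall F G : P, frank F = (j%:Z - 2)%R -> frank G = (j%:Z + 1)%R ->
    fle F G -> section_is_gon (entry p j) F G.

Definition is_tight (P : ranked_rel) (p : seq nat) : Prop :=
  [set C : set P | is_flag C] #= `I_(2 * \prod_(k <- p) k).

Record poset_aut (P : ranked_rel) := PosetAut {
  aut_fun :> P -> P;
  aut_inv : P -> P;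
  aut_funK : cancel aut_fun aut_inv;
  aut_invK : cancel aut_inv aut_fun;
  aut_le : forall F G, fle (aut_fun F) (aut_fun G) <-> fle F G
}.

Section Automorphisms.
Context (P : ranked_rel).
Implicit Types a b c : poset_aut P.

HB.instance Definition _ := gen_eqMixin (poset_aut P).
HB.instance Definition _ := gen_choiceMixin (poset_aut P).

Lemma poset_aut_ext a b : aut_fun a =1 aut_fun b -> a = b.
Proof.
case: a b => [f f' fK f'K fle] [g g' gK g'K gle] /= fg.
have {}fg : f = g by apply: funext.
case: _ / fg in gK g'K gle *.
have f'g' : f' = g' by apply: funext => x; rewrite -[x in LHS]g'K fK.
case: _ / f'g' in gK g'K *.
by congr PosetAut; apply: Prop_irrelevance.
Qed.

Definition aut_one : poset_aut P :=
  @PosetAut P id id (fun=> erefl) (fun=> erefl) (fun _ _ => iff_refl _).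

Fact aut_inv_le a F G : fle (aut_inv a F) (aut_inv a G) <-> fle F G.
Proof. by rewrite -(aut_le a) !aut_invK. Qed.

Definition aut_inverse a : poset_aut P :=
  PosetAut (aut_invK a) (aut_funK a) (aut_inv_le a).

Fact aut_comp_le a b F G : fle ((b \o a) F) ((b \o a) G) <-> fle F G.
Proof. by rewrite /= !aut_le. Qed.

(* Automorphisms act on the right: a * b is a followed by b. *)
Definition aut_mul a b : poset_aut P :=
  PosetAut (can_comp (aut_funK b) (aut_funK a))
           (can_comp (aut_invK a) (aut_invK b)) (aut_comp_le a b).

Fact aut_mulA : associative aut_mul.
Proof. by move=> a b c; apply: poset_aut_ext. Qed.
Fact aut_mul1 : left_id aut_one aut_mul.
Proof. by move=> a; apply: poset_aut_ext. Qed.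
Fact aut_mulr1 : right_id aut_one aut_mul.
Proof. by move=> a; apply: poset_aut_ext. Qed.
Fact aut_mulV : left_inverse aut_one aut_inverse aut_mul.
Proof. by move=> a; apply: poset_aut_ext => F /=; rewrite aut_invK. Qed.
Fact aut_mulrV : right_inverse aut_one aut_inverse aut_mul.
Proof. by move=> a; apply: poset_aut_ext => F /=; rewrite aut_funK. Qed.

HB.instance Definition _ := isGroup.Build (poset_aut P)
  aut_mulA aut_mul1 aut_mulr1 aut_mulV aut_mulrV.

End Automorphisms.

Section Regularity.
Context (P : ranked_rel).
Implicit Types (Phi Psi : set P).

Definition is_regular : Prop :=
  forall Phi Psi, is_flag Phi -> is_flag Psi ->
    exists a : poset_aut P, a @` Phi = Psi.

Definition flag_adjacent (j : nat) Phi Psi : Prop :=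
  [/\ is_flag Phi, is_flag Psi, Phi <> Psi
    & forall F, frank F <> (j%:Z)%R -> (Phi F <-> Psi F)].

Definition base_reflections (m : nat) Phi (rho : nat -> poset_aut P) : Prop :=
  forall j, j < m -> flag_adjacent j Phi (rho j @` Phi).

Definition rotation_subgroup (m : nat) (rho : nat -> poset_aut P) :
    set (poset_aut P) :=
  generated [set (rho j.-1 * rho j)%g | j in [set j : nat | 1 <= j < m]].

Definition is_orientably_regular (m : nat) : Prop :=
  is_regular /\
  exists (Phi : set P) (rho : nat -> poset_aut P),
    [/\ is_flag Phi, base_reflections m Phi rho
      & has_index (rotation_subgroup m rho) 2].

End Regularity.

Definition tight_orientably_regular_polytope (P : ranked_rel) (p : seq nat) :
    Prop :=
  [/\ is_polytope P (size p).+1, is_orientably_regular P (size p).+1,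
      has_type P p & is_tight P p].

(* The tuple (p_1, ..., p_(m-1)) is a sequence p of naturals, so that the rank
   is m = (size p).+1. *)
Definition admissible (p : seq nat) : Prop :=
  (forall j, 1 <= j <= size p -> 2 <= entry p j) /\
  (forall j k, 1 <= j <= size p -> 1 <= k <= size p ->
     (k.+1 == j) || (k == j.+1) -> odd (entry p j) ->
     ~~ odd (entry p k) && (entry p k %| 2 * entry p j)).

Section Gamma.
Context (p : seq nat).

Definition gen_word (j : nat) : word 'I_(size p).+1 := word_gen (inord j).
Local Notation x := gen_word.

(* In the last three clauses the case p_j and p_(j+1) both odd is absent, as
   it does not occur for admissible tuples. *)
Inductive Gamma_relator : set (word 'I_(size p).+1) :=
| relator_involution j of j <= size p :
    Gamma_relator (word_exp (x j) 2)
| relator_rotation j of 1 <= j <= size p :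
    Gamma_relator (word_exp (x j.-1 ++ x j) (entry p j))
| relator_commute j k of j <= size p & k <= size p
    & (j.+2 <= k) || (k.+2 <= j) :
    Gamma_relator (word_exp (x j ++ x k) 2)
| relator_even_even j of 1 <= j & j.+1 <= size p
    & ~~ odd (entry p j) & ~~ odd (entry p j.+1) :
    Gamma_relator (word_exp (x j.-1 ++ x j ++ x j.+1 ++ x j) 2)
| relator_odd_even j of 1 <= j & j.+1 <= size p
    & odd (entry p j) & ~~ odd (entry p j.+1) :
    Gamma_relator
      (word_exp (x j.-1 ++ x j ++ x j.+1 ++ x j ++ x j.+1) 2)
| relator_even_odd j of 1 <= j & j.+1 <= size p
    & ~~ odd (entry p j) & odd (entry p j.+1) :
    Gamma_relator
      (word_exp (x j.+1 ++ x j ++ x j.-1 ++ x j ++ x j.-1) 2).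

Definition Gamma : groupType := presented Gamma_relator.

Definition Gamma_gen (k : 'I_(size p).+1) : Gamma :=
  \pi_(presented Gamma_relator) (word_gen k).

Definition Gamma_sub (j : 'I_(size p).+1) : set Gamma :=
  generated [set Gamma_gen k | k in [set k | k != j]].

(* Cosets carry their rank j, so that faces of distinct ranks are distinct
   even if some Gamma_j coincide. *)
Inductive coset_face :=
| face_least
| face_coset (j : 'I_(size p).+1) (A : set Gamma)
    of right_cosets (Gamma_sub j) A
| face_greatest.

Definition coset_face_le (F G : coset_face) : Prop :=
  match F, G with
  | face_least, _ | _, face_greatest => True
  | face_coset j A _, face_coset k B _ => j <= k /\ A `&` B !=set0
  | _, _ => False
  end.

Definition coset_face_rank (F : coset_face) : int :=
  match F with
  | face_least => (- 1)%R
  | face_coset j _ _ => ((j : nat)%:Z)%R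
  | face_greatest => ((size p).+1%:Z)%R
  end.

Definition coset_poset : ranked_rel :=
  RankedRel coset_face_le coset_face_rank.

End Gamma.

(* Main.v *)
Require Import Defs.
From Stdlib Require Import Relation_Operators.
From mathcomp Require Import all_boot all_order ssralg ssrnum ssrint zify.
From mathcomp Require Import boolp classical_sets functions cardinality.

(* Write x_0, ..., x_(n-1) for the generators of Gamma(p_1, ..., p_(n-1)). Since
   p_(i-1) and p_(i+1) are even, killing x_j for j > i, resp. for j < i - 1,
   respects the relators, so that L = Gamma(p_1, ..., p_i) and
   R = Gamma(p_i, ..., p_(n-1)) are retracts, and both retract onto the dihedral
   group <x_(i-1), x_i>. The relators r_i make the normal closure of the x_j with
   j > i equal to the subgroup generated by these x_j and their conjugates by
   x_i; hence it lies in R, and Gamma is the fibre product of L and R over the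
   dihedral group. Being a tight orientably-regular polytope amounts to
   conditions on parabolic subgroups, on cosets of the stabilizer of the base
   flag, on orders of rotations and on parity, and these can be checked on the
   two projections of the fibre product. *)

Set Implicit Arguments.
Unset Strict Implicit.
Unset Printing Implicit Defensive.

(** * Generated subgroups and right cosets *)

Section Subgroups.
Context (G : groupType).
Implicit Types (A : set G) (x y g h : G).
Local Open Scope group_scope.
Local Open Scope classical_set_scope.

(** Hypotheses and conclusion speak of face posets, while the fibre product speaks of groups, so the
    translation is needed in both directions; it is proved once, for any group generated by
    involutions on a string with a parity homomorphism. The obstacle is that the stabilizer of the
    base flag, the intersection of all [Gamma_j], is not visibly trivial or even normal. Its
    normality is deduced from rigidity of automorphisms, and parity is what keeps reflections out of
    it.

    Evenness of the two neighbours of [p_i] enters twice. Killing one generator of a rotation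
    relator leaves a power of an involution, which is harmless only for an even exponent. Moreover,
    [p_(i+1)] even restricts [r_i] to two shapes, each of which tells how [x_(i-1)] conjugates
    [x_i x_(i+1) x_i].

    The flag count is the order of a fibre product: [2 p_1 ... p_(n-1)] is the product of
    [2 p_1 ... p_i] and [2 p_i ... p_(n-1)] divided by [2 p_i], the order of the shared dihedral
    group. *)

Lemma generated_subgroup A : is_subgroup (generated A).
Proof.
split=> [|x y Ax Ay|x Ax] H HA; have [[H1 HM HV] AH] := HA => //.
  by apply: HM; [apply: Ax|apply: Ay].
by apply: HV; apply: Ax.
Qed.

Lemma generatedT A x : A x -> generated A x.
Proof. by move=> Ax H [_]; apply. Qed.

Lemma generated_min A (H : set G) : is_subgroup H -> A `<=` H -> generated A `<=` H.
Proof. by move=> sH AH x; apply. Qed.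

Lemma subgroup_divC (H : set G) g h : is_subgroup H -> H (g * h^-1) -> H (h * g^-1).
Proof. by move=> [_ _ HV] /HV; rewrite invgF. Qed.

Lemma right_coset_eq (H : set G) g h : is_subgroup H ->
  right_coset H g = right_coset H h <-> H (g * h^-1).
Proof.
move=> [H1 HM HV]; split=> [e|Hgh].
  have : right_coset H g g by exists 1; rewrite ?mul1g.
  by rewrite e => -[k Hk <-]; rewrite mulgK.
apply/seteqP; split=> _ [k Hk <-].
  by exists (k * (g * h^-1)); [apply: HM|rewrite !mulgA mulgVK].
exists (k * (g * h^-1)^-1); first by apply: HM => //; apply: HV.
by rewrite invgF !mulgA mulgVK.
Qed.

Lemma right_cosetP (H : set G) g h : right_coset H g h <-> H (h * g^-1).
Proof.
split=> [[k Hk <-]|Hh]; first by rewrite mulgK.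
by exists (h * g^-1); rewrite ?mulgVK.
Qed.

End Subgroups.

(** * String groups generated by involutions *)

Section StringGroup.
Context (G : groupType) (X : nat -> G).
Implicit Types (S T : nat -> bool) (g h u v : G) (k r : nat).
Local Open Scope group_scope.
Local Open Scope classical_set_scope.

Definition par S : set G := generated [set X k | k in [set k | S k]].

Lemma par_subgroup S : is_subgroup (par S).
Proof. exact: generated_subgroup. Qed.

Lemma par1 S : par S 1. Proof. by case: (par_subgroup S). Qed.

Lemma parM S g h : par S g -> par S h -> par S (g * h).
Proof. by case: (par_subgroup S) => _ + _; apply. Qed.

Lemma parV S g : par S g -> par S g^-1.
Proof. by case: (par_subgroup S) => _ _; apply. Qed.

Lemma parF S g h : par S g -> par S h -> par S (g * h^-1).
Proof. by move=> Sg Sh; apply: parM => //; apply: parV. Qed.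

Lemma par_gen S k : S k -> par S (X k).
Proof. by move=> Sk; apply: generatedT; exists k. Qed.

Lemma par_sub S T : (forall k, S k -> T k) -> par S `<=` par T.
Proof.
move=> ST; apply: generated_min; first exact: par_subgroup.
by move=> _ [k /ST Tk <-]; apply: par_gen.
Qed.

Definition fix_par r : set G := par (fun k => k != r).

Definition base_stab : set G := [set g | forall r, fix_par r g].

Lemma base_stab_subgroup : is_subgroup base_stab.
Proof.
split=> [r|g h Bg Bh r|g Bg r]; first exact: par1.
  exact: parM (Bg r) (Bh r).
exact: parV (Bg r).
Qed.

(** [X] is total, with value 1 outside [1..m], so that retractions become plain shifts and
    truncations of indices. [od] is the parity of word length. *)
Record string_group (m : nat) (od : G -> bool) : Prop := StringGroup {
  strX0 : forall k, ~~ (0 < k <= m) -> X k = 1;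
  strXX : forall k, X k * X k = 1;
  strXC : forall j k, j.+1 < k -> X j * X k = X k * X j;
  strT : forall g, par xpredT g;
  strM : forall g h, od (g * h) = od g (+) od h;
  strX : forall k, 0 < k <= m -> od (X k)
}.

Context (m : nat) (od : G -> bool) (SG : string_group m od).
Let XX := strXX SG.
Let XC := strXC SG.

Lemma str1 : od 1 = false.
Proof. by have := strM SG 1 1; rewrite mulg1; case: (od 1). Qed.

Lemma strV g : od g^-1 = od g.
Proof. by have := strM SG g g^-1; rewrite mulgV str1; do 2 case: od. Qed.

Lemma genV k : (X k)^-1 = X k.
Proof. exact/mulg1_eq/XX. Qed.

Lemma genK k : cancel (fun g => g * X k) (fun g => g * X k).
Proof. by move=> g; rewrite -mulgA XX mulg1. Qed.

Lemma par_indl S (Q : G -> Prop) : Q 1 ->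
  (forall k h, S k -> Q h -> Q (X k * h)) -> forall g, par S g -> Q g.
Proof.
move=> Q1 QX g Sg.
(* Left multiplication by [g] and by [g^-1] must both preserve [Q]: with only one of the two demands
   the set would not be closed under inverses. *)
have := @generated_min _ [set X k | k in [set k | S k]]
  [set g | (forall h, Q h -> Q (g * h)) /\ (forall h, Q h -> Q (g^-1 * h))].
move=> /(_ _ _ _ Sg) [||+ _]; last by move/(_ _ Q1); rewrite mulg1.
  split=> [|x y [Qx QVx] [Qy QVy]|x [Qx QVx]].
  - by split=> h; rewrite ?invg1 mul1g.
  - split=> h Qh; first by rewrite -mulgA; apply/Qx/Qy.
    by rewrite invgM -mulgA; apply/QVy/QVx.
  - by split=> h; rewrite ?invgK; [apply: QVx|apply: Qx].
by move=> _ [k Sk <-] /=; rewrite genV; split=> h; apply: QX.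
Qed.

Lemma par_indr S (Q : G -> Prop) : Q 1 ->
  (forall k h, S k -> Q h -> Q (h * X k)) -> forall g, par S g -> Q g.
Proof.
move=> Q1 QX g /parV; rewrite -[in Q g](invgK g).
apply: (@par_indl _ (fun h => Q h^-1)) => [|k h Sk Qh]; first by rewrite invg1.
by rewrite invgM genV; apply: QX.
Qed.

Lemma par_commute S T : (forall j k, S j -> T k -> X j * X k = X k * X j) ->
  forall u v, par S u -> par T v -> u * v = v * u.
Proof.
move=> ST u v Su Tv; apply: (par_indl (Q := fun u => u * v = v * u)) Su => [|j u' Sj IH].
  by rewrite mul1g mulg1.
rewrite -mulgA IH !mulgA; congr (_ * _).
apply: (par_indl (Q := fun v => X j * v = v * X j)) Tv => [|k v' Tk IH'].
  by rewrite mul1g mulg1.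
by rewrite mulgA ST // -!mulgA IH'.
Qed.

Lemma par_lt_gt_commute a b u v : a <= b ->
  par (fun k => k < a) u -> par (fun k => b < k) v -> u * v = v * u.
Proof.
move=> ab; apply: par_commute => j k ja bk; apply: XC.
lia.
Qed.

Lemma par1_cases k g : par (fun j => j == k) g -> g = 1 \/ g = X k.
Proof.
apply: (par_indl (Q := fun g => g = 1 \/ g = X k)) => [|j h /eqP -> [->|->]]; first by left.
  by right; rewrite mulg1.
by left; apply: XX.
Qed.

(** Removing a node from a string leaves two parts whose generators commute, so every word can be
    sorted. *)
Lemma fix_par_split k g : fix_par k g ->
  exists u v, [/\ par (fun j => j < k) u, par (fun j => k < j) v & g = u * v].
Proof.
apply: (par_indl (Q := fun g => exists u v,
  [/\ par (fun j => j < k) u, par (fun j => k < j) v & g = u * v])).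
  by exists 1, 1; split; rewrite ?mulg1 //; apply: par1.
move=> j h jk [u [v [Lu Rv ->]]]; case: (ltngtP j k) => [lt|gt|e].
- exists (X j * u), v; split=> //; last by rewrite mulgA.
  by apply: parM => //; apply: par_gen.
- exists u, (X j * v); split=> //; first by apply: parM => //; apply: par_gen.
  rewrite !mulgA; congr (_ * _); apply/esym/(@par_lt_gt_commute k k) => //.
  exact: par_gen.
- by rewrite e eqxx in jk.
Qed.

Lemma fix_par_out r g : ~~ (0 < r <= m) -> fix_par r g.
Proof.
move=> r_out; apply: par_indl (strT SG g) => [|k h _ Qh]; first exact: par1.
apply: parM => //; case: (eqVneq k r) => [->|kr]; last exact: par_gen.
by rewrite (strX0 SG) //; apply: par1.
Qed.

Lemma par_lt_fix r s g : par (fun k => k < r) g -> r <= s -> fix_par s g.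
Proof. by move=> + rs; apply: par_sub => k; lia. Qed.

Lemma par_gt_fix r s g : par (fun k => r < k) g -> s <= r -> fix_par s g.
Proof. by move=> + rs; apply: par_sub => k; lia. Qed.

Lemma par_itv_fix a b r g : par (fun k => a < k < b) g -> ~~ (a < r < b) -> fix_par r g.
Proof.
by move=> + r_out; apply: par_sub => k kab; apply: contraNneq r_out => <-.
Qed.

(** Here [c] witnesses the incidence of the faces of [f] and [h]. When [c * f^-1] is split at [r],
    its lower factor lies in [fix_par l] and is absorbed there, so generators above [r] suffice to
    pass from one face to the other. *)
Lemma common_right r l c f h : r < l ->
  fix_par r (c * f^-1) -> fix_par l (c * h^-1) ->
  exists v, par (fun k => r < k) v /\ fix_par l (v * f * h^-1).
Proof.
move=> rl /fix_par_split[u [v [Lu Rv e]]] lc; exists v; split=> //.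
have -> : v * f = u^-1 * c by rewrite -[c](mulgVK f) e !mulgA mulVg mul1g.
by rewrite -mulgA; exact: parM (parV (par_lt_fix Lu (ltnW rl))) lc.
Qed.

Lemma common_left r l c f h : l < r ->
  fix_par r (c * f^-1) -> fix_par l (c * h^-1) ->
  exists u, par (fun k => k < r) u /\ fix_par l (u * f * h^-1).
Proof.
move=> lr /fix_par_split[u [v [Lu Rv e]]] lc; exists u; split=> //.
have -> : u * f = v^-1 * c.
  by rewrite -[c](mulgVK f) e (@par_lt_gt_commute r r u v) // !mulgA mulVg mul1g.
by rewrite -mulgA; exact: parM (parV (par_gt_fix Rv (ltnW lr))) lc.
Qed.

Lemma common_both r l s c d f h : r < l -> l < s ->
  fix_par r (c * f^-1) -> fix_par l (c * h^-1) ->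
  fix_par s (d * f^-1) -> fix_par l (d * h^-1) ->
  exists y, [/\ par (fun k => r < k) y, par (fun k => k < s) y
    & fix_par l (y * f * h^-1)].
Proof.
move=> rl ls rc lc sd ld.
have [v [Rv lv]] := common_right rl rc lc.
have [u [Lu lu]] := common_left ls sd ld.
have : fix_par l (v * u^-1).
  have -> : v * u^-1 = (v * f * h^-1) * (u * f * h^-1)^-1.
    by rewrite !invgM invgK !mulgA !mulgVK mulgK.
  exact: parF.
move=> /fix_par_split[w [z [Lw Rz e]]].
have zv : z^-1 * v = w * u.
  by rewrite -[v](mulgVK u) e (@par_lt_gt_commute l l w z) // !mulgA mulVg mul1g.
exists (z^-1 * v); split.
- by apply: parM => //; apply: parV; apply: par_sub Rz => k; lia.
- by rewrite zv; apply: parM => //; apply: par_sub Lw => k; lia.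
- by rewrite -!mulgA mulgA in lv *; exact: parM (parV (par_gt_fix Rz (leqnn l))) lv.
Qed.

End StringGroup.

(** * Coset geometries *)

Section CosetGeometry.
Context (G : groupType) (X : nat -> G) (m : nat) (od : G -> bool).
Context (SG : string_group X m od).
Implicit Types (g h u v c : G) (r s k : nat).
Local Open Scope group_scope.
Local Open Scope classical_set_scope.
Local Open Scope card_scope.
Local Notation par := (par X).
Local Notation fix_par := (fix_par X).
Local Notation base_stab := (base_stab X).

(* The indices of faces are shifted: [fc r g] has rank [r - 1], and the least
   and greatest faces are [fc 0 g] and [fc m.+1 g], for which [fix_par r] is
   the whole group. *)
Record coset_geometry (P : ranked_rel) (fc : nat -> G -> P) : Prop := CosetGeometry {
  fc_surj : forall F, exists r g, r <= m.+1 /\ F = fc r g;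
  fc_rank : forall r g, r <= m.+1 -> frank (fc r g) = (r%:Z - 1)%R;
  fc_le : forall r s g h, r <= m.+1 -> s <= m.+1 ->
    fle (fc r g) (fc s h) <->
    r <= s /\ exists c, fix_par r (c * g^-1) /\ fix_par s (c * h^-1);
  fc_eq : forall r g h, r <= m.+1 -> fc r g = fc r h <-> fix_par r (g * h^-1)
}.

Context (P : ranked_rel) (fc : nat -> G -> P) (CG : coset_geometry fc).
Let surj := fc_surj CG.
Let rank := fc_rank CG.
Let le_fc := fc_le CG.
Let eq_fc := fc_eq CG.

Lemma fc_index r s g h : r <= m.+1 -> s <= m.+1 -> fc r g = fc s h -> r = s.
Proof. by move=> rm sm e; have := rank g rm; rewrite e rank //; lia. Qed.

Lemma fc_le_diag r s g : r <= s -> s <= m.+1 -> fle (fc r g) (fc s g).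
Proof.
move=> rs sm; apply/le_fc; rewrite ?(leq_trans rs) //; split=> //.
by exists g; rewrite mulgV; split; apply: par1.
Qed.

Lemma fc_le_common r s g h : r <= m.+1 -> s <= m.+1 -> fle (fc r g) (fc s h) ->
  r <= s /\ exists c, fc r g = fc r c /\ fc s h = fc s c.
Proof.
move=> rm sm /le_fc[] // rs [c [rc sc]]; split=> //; exists c.
by split; apply/esym/eq_fc.
Qed.

Lemma fc_le_same r g h : r <= m.+1 -> fle (fc r g) (fc r h) -> fc r g = fc r h.
Proof. by move=> rm /fc_le_common[] // _ [c [-> ->]]. Qed.

Lemma fc_lt r s g h : r <= m.+1 -> s <= m.+1 -> flt (fc r g) (fc s h) -> r < s.
Proof.
move=> rm sm [gh ne]; have [rs _] := fc_le_common rm sm gh.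
rewrite ltn_neqAle rs andbT; apply: contra_notN ne => /eqP e.
by rewrite -{}e in sm gh *; apply: fc_le_same.
Qed.

Lemma fc_le_right r s g h : r < s -> s <= m.+1 -> fle (fc r g) (fc s h) ->
  exists v, par (fun k => r < k) v /\ fc s h = fc s (v * g).
Proof.
move=> rs sm /le_fc[||_ [c [rc sc]]]; rewrite ?(leq_trans (ltnW rs)) //.
have [v [Rv lv]] := common_right SG rs rc sc.
by exists v; split=> //; apply/esym/eq_fc.
Qed.

Lemma fc_le_both r k s g h : r < k -> k < s -> s <= m.+1 ->
  fle (fc r g) (fc k h) -> fle (fc k h) (fc s g) ->
  exists y, [/\ par (fun j => r < j) y, par (fun j => j < s) y
    & fc k h = fc k (y * g)].
Proof.
move=> rk ks sm; have km := leq_trans (ltnW ks) sm.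
move=> /le_fc[||_ [c [rc kc]]] //; first exact: leq_trans (ltnW rk) km.
move=> /le_fc[||_ [d [kd sd]]] //.
have [y [Ry Ly ky]] := common_both SG rk ks rc kc sd kd.
by exists y; split=> //; apply/esym/eq_fc.
Qed.

Lemma geometry_poset : is_poset P.
Proof.
split=> [F|F F'|F F' F''].
- by have [r [g [rm ->]]] := surj F; apply: fc_le_diag.
- have [r [g [rm ->]]] := surj F; have [s [h [sm ->]]] := surj F'.
  move=> le1 le2; have [rs _] := fc_le_common rm sm le1.
  have [sr _] := fc_le_common sm rm le2.
  have e : r = s by lia.
  by rewrite -{}e in sm le1 *; apply: fc_le_same.
have [r [g [rm ->]]] := surj F; have [s [h [sm ->]]] := surj F'.
have [t [f [tm ->]]] := surj F''.
move=> /(fc_le_common rm sm)[rs [c [-> e]]]; rewrite e => le2.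
have [st _] := fc_le_common sm tm le2.
move: st; rewrite leq_eqVlt => /predU1P[est|st].
  by rewrite -{}est in tm le2 *; rewrite -(fc_le_same _ le2) //; apply: fc_le_diag.
have [v [Rv ->]] := fc_le_right st tm le2.
apply/le_fc => //; split; first exact: leq_trans (ltnW st).
exists (v * c); rewrite mulgK mulgV; split; last exact: par1.
exact: par_gt_fix Rv rs.
Qed.

Lemma geometry_rank_lt (F F' : P) : flt F F' -> (frank F < frank F')%R.
Proof.
have [r [g [rm ->]]] := surj F; have [s [h [sm ->]]] := surj F'.
by move=> /(fc_lt rm sm) rs; rewrite !rank //; lia.
Qed.

Definition base_flag g : set P := [set F | exists2 r, r <= m.+1 & F = fc r g].

Lemma base_flag_chain g : is_chain (base_flag g).
Proof.
move=> _ _ [r rm ->] [s sm ->]; case: (leqP r s) => [rs|/ltnW sr].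
  by left; apply: fc_le_diag.
by right; apply: fc_le_diag.
Qed.

(** Going up in rank, one representative [g] serves all chain faces of index at most [n], and [r] is
    the highest such index. The next face is reached from the top one by generators above [r], which
    leave the lower faces alone. The least face in the chain gives the induction its first top
    face. *)
Lemma chain_sub_flag (C : set P) : is_chain C -> C (fc 0 1) ->
  exists g, C `<=` base_flag g.
Proof.
move=> chC C0.
suff H n : n <= m.+1 -> exists g r, [/\ r <= n, C (fc r g) &
    forall s h, s <= n -> C (fc s h) -> s <= r /\ fc s h = fc s g].
  have [g [r [_ _ Cg]]] := H _ (leqnn _); exists g => F.
  have [s [h [sm ->]]] := surj F => /(Cg _ _ sm)[_ ->]; by exists s.
elim: n => [_|n IH nm].
  exists 1, 0; split=> // s h; rewrite leqn0 => /eqP -> _; split=> //.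
  by apply/eq_fc => //; apply: (fix_par_out SG).
have [g [r [rn Cg Cgs]]] := IH (ltnW nm).
have [[h Ch]|nCh] := pselect (exists h, C (fc n.+1 h)); last first.
  exists g, r; split=> // [|s h]; first exact: leqW.
  by rewrite leq_eqVlt => /predU1P[-> Ch|/Cgs]; [case: nCh; exists h|apply].
have rm : r <= m.+1 by lia.
have [le|le] := chC _ _ Cg Ch; last first.
  by have [] := fc_le_common nm rm le; lia.
have [v [Rv e]] := fc_le_right (leq_ltn_trans rn (ltnSn n)) nm le.
exists (v * g), n.+1; split=> //; first by rewrite -e.
move=> s h' sn1 Ch'; have /predU1P[es|sn] : (s == n.+1) || (s < n.+1) by rewrite -leq_eqVlt.
- by split=> //; rewrite {}es in Ch' *; rewrite -e; case: (chC _ _ Ch Ch') => /fc_le_same -> //.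
- have [sr ->] := Cgs _ _ sn Ch'; split; first exact: leq_trans sr (leqW rn).
  apply/esym/eq_fc; first exact: leq_trans (leq_trans sr rn) (ltnW nm).
  by rewrite mulgK; apply: par_gt_fix Rv sr.
Qed.

Lemma base_flagP (C : set P) : is_flag C <-> exists g, C = base_flag g.
Proof.
split=> [[chC maxC]|[g ->]].
  have least F : fle (fc 0 1) F.
    have [r [g [rm ->]]] := surj F; apply/le_fc => //; split=> //.
    exists g; rewrite mulgV; split; last exact: par1.
    exact: (fix_par_out SG).
  have C0 : C (fc 0 1).
    have <- : C `|` [set fc 0 1] = C.
      apply: maxC => [F F' [CF|->] [CF'|->]|]; [exact: chC|by right|by left|by left|].
      by move=> F; left.
    by right.
  have [g Cg] := chain_sub_flag chC C0.
  by exists g; rewrite -(maxC _ (@base_flag_chain g) Cg).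
split=> [|D chD gD]; first exact: base_flag_chain.
apply/seteqP; split=> // F.
have [r [h [rm ->]]] := surj F => Dh.
have Dg : D (fc r g) by apply: gD; exists r.
exists r => //; case: (chD _ _ Dg Dh) => /fc_le_same -> //.
Qed.

Lemma base_flag_eq g h : base_flag g = base_flag h <-> base_stab (g * h^-1).
Proof.
split=> [e r|gh].
  case: (boolP (0 < r <= m)) => rm; last exact: (fix_par_out SG).
  have {}rm : r <= m.+1 by lia.
  have : base_flag h (fc r g) by rewrite -e; exists r.
  by move=> [s sm /[dup]/fc_index <-//]; apply: (eq_fc _ _ _).1.
apply/seteqP; split=> F [r rm ->]; exists r => //; apply/eq_fc => //.
exact: subgroup_divC (par_subgroup _ _) (gh r).
Qed.

(** A flag is encoded by the set of its representatives, which is a right coset of the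
    stabilizer. *)
Lemma card_flags : [set C : set P | is_flag C] #= right_cosets base_stab.
Proof.
have sB := base_stab_subgroup X.
have -> : [set C | is_flag C] = range base_flag.
  apply/seteqP; split=> [C /base_flagP[g ->]|_ [g _ <-]]; first by exists g.
  by apply/base_flagP; exists g.
pose f (C : set P) : set G := [set g | C = base_flag g].
have fE g : f (base_flag g) = right_coset base_stab g.
  apply/seteqP; split=> h; rewrite right_cosetP /f /= base_flag_eq;
  exact: subgroup_divC.
have -> : right_cosets base_stab = f @` range base_flag.
  apply/seteqP; split=> [_ [g _ <-]|_ [_ [g _ <-] <-]].
    by exists (base_flag g); [exists g|].
  by exists g.
rewrite card_eq_sym; apply: inj_card_eq => _ _ /set_mem[g _ <-] /set_mem[h _ <-].
by rewrite !fE => /(right_coset_eq _ _ sB) /base_flag_eq.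
Qed.

Lemma card_base_flag g : base_flag g #= `I_m.+2.
Proof.
have -> : base_flag g = (fun r => fc r g) @` `I_m.+2.
  by apply/seteqP; split=> [F [r rm ->]|F [r rm <-]]; exists r.
apply: inj_card_eq => r s /set_mem /= rm /set_mem /= sm; exact: fc_index.
Qed.

End CosetGeometry.

(** * Two-element sets *)

Section FiniteCardinals.
Local Open Scope classical_set_scope.
Local Open Scope card_scope.

Lemma card_I2P T (A : set T) : A #= `I_2 <-> exists a b, a <> b /\ A = [set a; b].
Proof.
split=> [/card_set_bijP[f [fA finj fsurj]]|[a [b [ab ->]]]].
  have [a Aa fa] := fsurj 0 isT; have [b Ab fb] := fsurj 1 isT.
  exists a, b; split=> [e|]; first by rewrite e fb in fa.
  apply/seteqP; split=> [c Ac|c [->|->]] //.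
  have := fA _ Ac => /= fc2.
  have : f c = 0 \/ f c = 1 by lia.
  by case=> fc; [left|right]; apply: finj; rewrite ?inE // ?fa ?fb.
have -> : [set a; b] = (fun n => if n == 0 then a else b) @` `I_2.
  apply/seteqP; split=> [c [->|->]|_ [[|[|//]] _ <-]]; [by exists 0|by exists 1|by left|by right].
apply: inj_card_eq => -[|[|n]] [|[|k]] /set_mem //= _ /set_mem //= _ e.
by case: ab.
Qed.

End FiniteCardinals.

(** * Automorphisms of a coset geometry *)

Section Automorphisms.
Context (G : groupType) (X : nat -> G) (m : nat) (od : G -> bool).
Context (SG : string_group X m od).
Context (P : ranked_rel) (fc : nat -> G -> P) (CG : coset_geometry X m fc).
Implicit Types (g h u v c : G) (r s k : nat) (a : poset_aut P).
Local Open Scope group_scope.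
Local Open Scope classical_set_scope.
Local Open Scope card_scope.
Local Notation par := (par X).
Local Notation fix_par := (fix_par X).
Local Notation base_stab := (base_stab X).
Local Notation base_flag := (base_flag m fc).
Let surj := fc_surj CG.
Let rank := fc_rank CG.
Let eq_fc := fc_eq CG.

Definition face_index (F : P) : nat := projT1 (cid (surj F)).
Definition face_rep (F : P) : G := projT1 (cid (projT2 (cid (surj F)))).

Lemma face_indexP F : face_index F <= m.+1 /\ F = fc (face_index F) (face_rep F).
Proof. exact: projT2 (cid (projT2 (cid (surj F)))). Qed.

(** Right multiplication respects right cosets. Faces being abstract here, it acts through a chosen
    representative; [translate_fc] shows that the choice does not matter. *)
Definition translate g (F : P) : P := fc (face_index F) (face_rep F * g).

Lemma translate_fc g r h : r <= m.+1 -> translate g (fc r h) = fc r (h * g).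
Proof.
move=> rm; rewrite /translate; have [im e] := face_indexP (fc r h).
have ir := fc_index CG rm im e; rewrite -ir in e *.
apply/eq_fc => //; rewrite mulgKA; apply/eq_fc => //; exact/esym.
Qed.

Lemma translateM g h F : translate h (translate g F) = translate (g * h) F.
Proof. by have [r [f [rm ->]]] := surj F; rewrite !translate_fc // mulgA. Qed.

Lemma translate1 F : translate 1 F = F.
Proof. by have [r [f [rm ->]]] := surj F; rewrite !translate_fc // mulg1. Qed.

Lemma translateK g : cancel (translate g) (translate g^-1).
Proof. by move=> F; rewrite translateM mulgV translate1. Qed.

Lemma translateVK g : cancel (translate g^-1) (translate g).
Proof. by move=> F; rewrite translateM mulVg translate1. Qed.

Lemma translate_le g F F' : fle (translate g F) (translate g F') <-> fle F F'.
Proof.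
have H h F1 F2 : fle F1 F2 -> fle (translate h F1) (translate h F2).
  have [r [f [rm ->]]] := surj F1; have [s [f' [sm ->]]] := surj F2.
  move=> /(fc_le_common CG rm sm)[rs [c [-> ->]]].
  by rewrite !translate_fc //; apply: (fc_le_diag CG).
by split=> [/(H g^-1)|/H//]; rewrite !translateK.
Qed.

Definition translation g : poset_aut P :=
  PosetAut (translateK g) (translateVK g) (translate_le g).

Lemma translationM g h : translation (g * h) = translation g * translation h.
Proof. by apply: poset_aut_ext => F /=; rewrite translateM. Qed.

Lemma translation1 : translation 1 = 1.
Proof. by apply: poset_aut_ext => F /=; rewrite translate1. Qed.

Lemma translationV g : translation g^-1 = (translation g)^-1.
Proof. by apply/esym/mulg1_eq; rewrite -translationM mulgV translation1. Qed.

Lemma image_base_flag g h : translation g @` base_flag h = base_flag (h * g).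
Proof.
apply/seteqP; split=> [_ [_ [r rm ->] <-]|F [r rm ->]].
  by exists r => //=; rewrite translate_fc.
by exists (fc r h); [exists r|rewrite /= translate_fc].
Qed.

Lemma geometry_regular : is_regular P.
Proof.
move=> Phi Psi /(base_flagP SG CG)[g ->] /(base_flagP SG CG)[h ->].
by exists (translation (g^-1 * h)); rewrite image_base_flag mulVKg.
Qed.

Lemma aut_flt a F F' : flt F F' -> flt (a F) (a F').
Proof.
move=> [le ne]; split; first exact/aut_le.
by move/(can_inj (aut_funK a)).
Qed.

(** Automorphisms preserve strict chains, so the image of a face has at least as many faces strictly
    below it in a chain. Used for the inverse as well, this shows that rank is preserved. *)
Lemma aut_index_le a r s g h : r <= m.+1 -> s <= m.+1 ->
  a (fc r g) = fc s h -> r <= s.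
Proof.
elim: r s h => // r IH s h rm sm e.
have [s' [h' [sm' e']]] := surj (a (fc r g)).
apply: leq_ltn_trans (IH _ _ (ltnW rm) sm' e') _.
apply: (fc_lt CG sm' sm (g := h') (h := h)).
rewrite -e' -e; apply: aut_flt.
split; first exact: (fc_le_diag CG).
by move/(fc_index CG (ltnW rm) rm); lia.
Qed.

Lemma aut_fc a r g : r <= m.+1 -> exists h, a (fc r g) = fc r h.
Proof.
move=> rm; have [s [h [sm e]]] := surj (a (fc r g)); exists h.
have rs := aut_index_le rm sm e.
have : aut_inverse a (fc s h) = fc r g by rewrite -e /= aut_funK.
by move/(aut_index_le sm rm) => sr; rewrite e; congr fc; lia.
Qed.

(** The diamond condition at the base flag: [X k] moves the face of index [k], and up to [base_stab]
    it is the only way to move that face alone. *)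
Definition thin : Prop :=
  (forall k, 0 < k <= m -> ~ fix_par k (X k)) /\
  (forall k g, 0 < k <= m -> (forall r, r != k -> fix_par r g) ->
     base_stab g \/ base_stab (g * X k)).

Context (TH : thin).

(** Fixing a flag propagates to its adjacent flags, since the diamond condition leaves one choice
    for the exchanged face; every flag is reached along a word in the generators. *)
Lemma aut_rigid a g : (forall r, r <= m.+1 -> a (fc r g) = fc r g) -> a = 1.
Proof.
move=> ag; apply: poset_aut_ext => F /=.
have [r [h [rm ->]]] := surj F.
have -> : h = (h * g^-1) * g by rewrite mulgVK.
move: (h * g^-1) (strT SG (h * g^-1)) => w Tw {F h}.
move: r rm; apply: (par_indl SG (Q := fun w => forall r, r <= m.+1 ->
  a (fc r (w * g)) = fc r (w * g))) Tw => [|k w' _ IH] r rm.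
  by rewrite mul1g ag.
case: (boolP (0 < k <= m)) => [km|/(strX0 SG) ->]; last by rewrite mul1g IH.
rewrite -mulgA; set f := w' * g in IH *.
have Xf s : s <= m.+1 -> s != k -> fc s (X k * f) = fc s f.
  move=> sm sk; apply/eq_fc => //; rewrite mulgK; apply: par_gen.
  by rewrite eq_sym.
case: (eqVneq r k) => [->{r rm}|rk]; last by rewrite Xf // IH.
have km' : k <= m.+1 by lia.
have [h ah] := aut_fc a (X k * f) km'.
have km1 : k.-1 < k by lia.
have [y [Ry Ly e]] : exists y, [/\ par (fun j => k.-1 < j) y,
    par (fun j => j < k.+1) y & fc k h = fc k (y * f)].
  apply: (fc_le_both SG CG) => //; first lia.
    rewrite -ah -(IH k.-1) -1?(Xf k.-1); try lia.
    by apply/aut_le/(fc_le_diag CG); lia.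
  rewrite -ah -(IH k.+1) -1?(Xf k.+1); try lia.
  by apply/aut_le/(fc_le_diag CG); lia.
(* The image of the exchanged face is either the old face, which injectivity of [a] forbids, or the
   exchanged face itself. *)
have [] : base_stab y \/ base_stab (y * X k).
- apply: TH.2 => // s sk; case: (ltnP s k) => ks.
    by apply: par_gt_fix Ry _; lia.
  by apply: par_lt_fix Ly _; lia.
- move=> By; have e' : fc k (y * f) = fc k f by apply/eq_fc; [lia|rewrite mulgK; apply: By].
  case: (TH.1 k km); have : a (fc k (X k * f)) = a (fc k f).
    by rewrite ah e e' IH //; lia.
  by move/(can_inj (aut_funK a))/eq_fc; rewrite mulgK; apply; lia.
- move=> By; rewrite ah e; apply/eq_fc; first lia.
  by rewrite invgM (genV SG) mulgA mulgK; apply: By.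
Qed.

Lemma translation_eq1 g : translation g = 1 <-> base_stab g.
Proof.
split=> [e r|Bg].
  case: (boolP (0 < r <= m)) => rm; last exact: (fix_par_out SG).
  have {}rm : r <= m.+1 by lia.
  have : translation g (fc r 1) = fc r 1 by rewrite e.
  by rewrite /= translate_fc // mul1g => /eq_fc; rewrite invg1 mulg1; apply.
apply: (@aut_rigid _ 1) => r rm /=; rewrite translate_fc // mul1g.
by apply/eq_fc => //; rewrite invg1 mulg1; apply: Bg.
Qed.

Lemma translation_eq g h : translation g = translation h <-> base_stab (g * h^-1).
Proof.
rewrite -translation_eq1 translationM translationV; split=> [->|/divg1_eq//].
exact: mulgV.
Qed.

(** By rigidity [base_stab] is the kernel of [translation], hence normal, which its definition as an
    intersection of parabolic subgroups does not show. *)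
Lemma base_stabJ g h : base_stab g -> base_stab (h^-1 * g * h).
Proof.
rewrite -!translation_eq1 !translationM => ->.
by rewrite mulg1 translationV mulVg.
Qed.

(** The image of the base flag lies in some [base_flag g], and rigidity applies to [a] followed by
    the translation by [g^-1]. *)
Lemma translation_surj a : exists g, a = translation g.
Proof.
have chC : is_chain (a @` base_flag 1).
  move=> _ _ [F CF <-] [F' CF' <-]; rewrite !aut_le.
  exact: (base_flag_chain CG CF CF').
have [|g ag] := chain_sub_flag SG CG chC.
  exists (fc 0 1); first by exists 0.
  have [h ->] := aut_fc a 1 (leq0n _); apply/eq_fc => //.
  exact: (fix_par_out SG).
exists g; apply: divg1_eq; rewrite -translationV.
apply: (@aut_rigid _ 1) => r rm /=.
have [h ah] := aut_fc a 1 rm.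
have [s sm e] : base_flag g (a (fc r 1)) by apply: ag; exists (fc r 1) => //; exists r.
rewrite e; rewrite ah in e; rewrite -(fc_index CG rm sm e).
by rewrite translate_fc // mulgV.
Qed.

Lemma subgroup_even (H : set G) : is_subgroup H ->
  (forall k, 0 < k < m -> H (X k * X k.+1)) ->
  forall g, if od g then H (g * X 1) else H g.
Proof.
move=> [H1 HM HV] HX.
have H1X k : 0 < k <= m -> H (X 1%N * X k).
  elim: k => // -[|k] IH km; first by rewrite (strXX SG).
  have -> : X 1%N * X k.+2 = (X 1%N * X k.+1) * (X k.+1 * X k.+2).
    by rewrite mulgA (genK SG).
  by apply: HM; [apply: IH; lia|apply: HX; lia].
move=> g; apply: (par_indr SG (Q := fun g => if od g then H (g * X 1%N) else H g))
  (strT SG g) => [|k h _]; first by rewrite (str1 SG).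
case: (boolP (0 < k <= m)) => [km|/(strX0 SG) ->]; last by rewrite mulg1.
rewrite (strM SG) (strX SG km) addbT; case: (od h) => /= Hh.
  have -> : h * X k = (h * X 1%N) * (X 1%N * X k).
    by rewrite mulgA (genK SG).
  by apply: HM => //; apply: H1X.
rewrite -mulgA; apply: HM => //.
by have := HV _ (H1X _ km); rewrite invgM !(genV SG).
Qed.

(** Adjacency alone pins down the reflection. Moved back to the base flag, it fixes all faces but
    one, so by thinness it acts as 1 or as [X j.+1], and 1 would not move the flag. *)
Lemma base_reflection_translation (phi : G) (rho : nat -> poset_aut P) :
  base_reflections m (base_flag phi) rho ->
  forall j, j < m -> rho j = translation (phi^-1 * X j.+1 * phi).
Proof.
move=> refl j jm; have [g rg] := translation_surj (rho j).
have := refl j jm; rewrite rg image_base_flag => -[_ _ ne adj].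
have jm1 : 0 < j.+1 <= m by lia.
have fixz r : r != j.+1 -> fix_par r (phi * g * phi^-1).
  move=> rj; case: (boolP (0 < r <= m)) => rm; last exact: (fix_par_out SG).
  have {}rm : r <= m.+1 by lia.
  have [] := adj (fc r phi); first by rewrite rank //; lia.
  move=> /(_ _)[|s sm e _]; first by exists r.
  move: (e); rewrite -(fc_index CG rm sm e) => /esym/eq_fc; exact.
case: (TH.2 _ _ jm1 fixz) => Bz.
  by case: ne; apply/esym/(base_flag_eq SG CG).
apply/translation_eq; have := base_stabJ phi Bz.
by rewrite !invgM invgK (genV SG) !mulgA mulVg mul1g.
Qed.

(** Up to conjugation by [phi], rotations are the translations by even elements. They form a
    subgroup of index 2 exactly when no odd element acts trivially; [0 < m] provides the odd
    generator [X 1]. *)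
Lemma rotation_index2 (phi : G) (rho : nat -> poset_aut P) : 0 < m ->
  base_reflections m (base_flag phi) rho ->
  has_index (rotation_subgroup m rho) 2 <-> (forall b, base_stab b -> ~~ od b).
Proof.
move=> m0 /base_reflection_translation rhoE.
set Rot := rotation_subgroup m rho.
have sRot : is_subgroup Rot := generated_subgroup _.
have [R1 RM RV] := sRot.
have trJ g h : translation (phi^-1 * (g * h) * phi) =
    translation (phi^-1 * g * phi) * translation (phi^-1 * h * phi).
  by rewrite -translationM !mulgA mulgK.
have evenR := @subgroup_even [set g | Rot (translation (phi^-1 * g * phi))].
have {evenR} evenR g : if od g then Rot (translation (phi^-1 * (g * X 1%N) * phi))
    else Rot (translation (phi^-1 * g * phi)).
  apply: (evenR _ _ g) => {g} [|k km].
    split=> [|g h Rg Rh|g Rg] /=.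
    - by rewrite mulg1 mulVg translation1.
    - by rewrite trJ; apply: RM.
    - have -> : phi^-1 * g^-1 * phi = (phi^-1 * g * phi)^-1 by rewrite !invgM invgK mulgA.
      by rewrite translationV; apply: RV.
  rewrite /= trJ; apply: generatedT; exists k => //.
  by rewrite !rhoE; [rewrite prednK//; lia|lia|lia].
have X1odd : od (X 1%N) by apply: (strX SG); lia.
split=> [ind b Bb|evB].
  apply/negP => odb.
  (* An odd element acting trivially would make a reflection a rotation; the rotation subgroup would
     be everything and have a single coset. *)
  have RX1 : Rot (translation (phi^-1 * X 1%N * phi)).
    have := evenR b; rewrite odb trJ.
    by rewrite (translation_eq1 _).2 ?mul1g //; apply: base_stabJ.
  have RT a : Rot a.
    have [g ->] := translation_surj a.
    have -> : g = phi^-1 * (phi * g * phi^-1) * phi.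
      by rewrite !mulgA mulVg mul1g mulgVK.
    have := evenR (phi * g * phi^-1); case: ifP => // _.
    rewrite trJ => /RM /(_ (RV _ RX1)); by rewrite mulgK.
  have [A [B [AB e]]] := (card_I2P _).1 ind.
  have [a _ Aa] : right_cosets Rot A by rewrite e; left.
  have [b' _ Bb'] : right_cosets Rot B by rewrite e; right.
  by case: AB; rewrite -Aa -Bb'; apply/right_coset_eq.
have Rev a : Rot a -> exists2 g, ~~ od g & a = translation g.
  apply: (generated_min (H := [set a | exists2 g, ~~ od g & a = translation g])).
    split=> [|_ _ [g og ->] [h oh ->]|_ [g og ->]].
    - by exists 1; rewrite ?(str1 SG) // translation1.
    - by exists (g * h); [rewrite (strM SG) (negbTE og) (negbTE oh)|rewrite translationM].
    - by exists g^-1; rewrite ?(strV SG) // translationV.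
  move=> _ [k /= km <-]; rewrite !rhoE; [|lia|lia].
  rewrite -translationM.
  exists (phi^-1 * X k.-1.+1 * phi * (phi^-1 * X k.+1 * phi)) => //.
  have oX j : 0 < j <= m -> od (X j) = true by exact: (strX SG).
  by rewrite !(strM SG) (strV SG) !oX; [case: (od phi)|lia|lia].
have tX : Rot (translation (X 1%N)) -> False.
  by move=> /Rev[g og /translation_eq /evB]; rewrite (strM SG) (strV SG) X1odd (negbTE og).
have evR g : ~~ od g -> Rot (translation g).
  move=> og; have := evenR (phi * g * phi^-1).
  rewrite !(strM SG) (strV SG) (negbTE og) addbF addbb.
  by rewrite !mulgA mulVg mul1g mulgVK.
apply/card_I2P; exists (right_coset Rot 1), (right_coset Rot (translation (X 1%N))).
split=> [/(right_coset_eq _ _ sRot)|].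
  by rewrite mul1g => /RV; rewrite invgK.
apply/seteqP; split=> [_ [a _ <-]|_ [->|->]]; last 2 first.
- by exists 1.
- by exists (translation (X 1%N)).
have [g ->] := translation_surj a; case og : (od g); [right|left];
  apply/(right_coset_eq _ _ sRot).
  by rewrite -translationV -translationM; apply: evR; rewrite (strM SG) (strV SG) og X1odd.
by rewrite invg1 mulg1; apply: evR; rewrite og.
Qed.

End Automorphisms.

(** * Polytopality in terms of the group *)

Section TightCosetGeometry.
Context (p : seq nat).
Local Notation m := (size p).+1.
Context (G : groupType) (X : nat -> G) (od : G -> bool).
Context (SG : string_group X m od).
Context (P : ranked_rel) (fc : nat -> G -> P) (CG : coset_geometry X m fc).
Implicit Types (g h u v c : G) (r s k : nat).
Local Open Scope group_scope.
Local Open Scope classical_set_scope.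
Local Open Scope card_scope.
Local Notation par := (par X).
Local Notation fix_par := (fix_par X).
Local Notation base_stab := (base_stab X).
Local Notation base_flag := (base_flag m fc).
Local Notation thin := (thin X m).
Let surj := fc_surj CG.
Let rank := fc_rank CG.
Let le_fc := fc_le CG.
Let eq_fc := fc_eq CG.

(** The group form of strong connectedness: flags that agree with the base flag outside an interval
    are joined to it by exchanging only faces inside. *)
Definition interval_generated : Prop := forall a b g,
  (forall r, ~~ (a < r < b) -> fix_par r g) ->
  exists u v, [/\ base_stab u, par (fun k => a < k < b) v & g = u * v].

(* The stabilizer [base_stab] of the base flag is not known to be trivial, so
   everything is stated modulo it: interval parabolic subgroups intersect as in
   a string C-group, there are [2 p_1 ... p_(m-1)] flags, the rotations have
   their full orders, and orientation is well defined. *)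
Definition tight_group : Prop :=
  [/\ interval_generated,
      right_cosets base_stab #= `I_(2 * \prod_(k <- p) k),
      forall j t, 0 < j <= size p ->
        base_stab ((X j * X j.+1) ^+ t) -> entry p j %| t
    & forall b, base_stab b -> ~~ od b].

Lemma fc_stab u k g : base_stab u -> k <= m.+1 -> fc k (u * g) = fc k g.
Proof. by move=> Bu km; apply/eq_fc => //; rewrite mulgK; apply: Bu. Qed.

Lemma fix_outside a b y : par (fun k => a < k) y -> par (fun k => k < b) y ->
  forall r, ~~ (a < r < b) -> fix_par r y.
Proof.
move=> Ry Ly r; rewrite negb_and -!leqNgt => /orP[ra|br].
  exact: par_gt_fix Ry ra.
exact: par_lt_fix Ly br.
Qed.

Lemma section_proper_fc a b g H : a <= b -> b <= m.+1 ->
  section_proper (fc a g) (fc b g) H ->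
  exists k y, [/\ a < k < b, (forall r, ~~ (a < r < b) -> fix_par r y) & H = fc k (y * g)].
Proof.
move=> ab bm; have am := leq_trans ab bm.
have [k [h [km ->]]] := surj H => -[lt1 lt2].
have kb := fc_lt CG km bm lt2; have ak := fc_lt CG am km lt1.
have [y [Ry Ly e]] := fc_le_both SG CG ak kb bm lt1.1 lt2.1.
exists k, y; split=> //; first by rewrite ak.
exact: fix_outside.
Qed.

Lemma fc_flt r s g : r < s -> s <= m.+1 -> flt (fc r g) (fc s g).
Proof.
move=> rs sm; split; first exact: (fc_le_diag CG _ (ltnW rs)).
by move/(fc_index CG (leq_trans (ltnW rs) sm) sm); lia.
Qed.

Lemma fc_section_proper a b k y g : a < k < b -> b <= m.+1 ->
  fix_par a y -> fix_par b y ->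
  section_proper (fc a g) (fc b g) (fc k (y * g)).
Proof.
move=> /andP[ak kb] bm ay b_y.
have -> : fc a g = fc a (y * g).
  by apply/esym/eq_fc; [lia|rewrite mulgK].
have -> : fc b g = fc b (y * g) by apply/esym/eq_fc => //; rewrite mulgK.
by split; apply: fc_flt => //; lia.
Qed.

Section Sufficiency.
Context (TG : tight_group).
Let C1 : interval_generated. Proof. by case: TG. Qed.
Let C5 b : base_stab b -> ~~ od b. Proof. by case: TG => _ _ _; apply. Qed.

(** If [X k] fixed the face of index [k] it would lie in [base_stab], against parity. The other half
    is [interval_generated] for an interval with the single interior index [k]. *)
Lemma tight_group_thin : thin.
Proof.
split=> [k km fX|k g km fg].
  have := strX SG km; apply/negP/C5 => r.
  by case: (eqVneq k r) => [<-//|kr]; apply: par_gen.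
have [|u [v [Bu Sv ->]]] := C1 (a := k.-1) (b := k.+1) (g := g).
  by move=> r rk; apply: fg; lia.
have : par (fun j => j == k) v by apply: par_sub Sv => j; lia.
case/(par1_cases SG) => ->; first by left; rewrite mulg1.
by right; rewrite (genK SG).
Qed.
Let TH := tight_group_thin.

(** A prefix [X j] exchanges only the face of index [j], so the path continues through a face of
    another index [l]; [a.+2 < b] guarantees that one exists inside the interval. Paths are directed
    by definition, so both directions are carried along. *)
Lemma connected_interval a b c v : a.+2 < b -> b <= m.+1 ->
  par (fun k => a < k < b) v -> forall k, a < k < b ->
  clos_refl_trans P (section_adj (fc a c) (fc b c)) (fc a.+1 c) (fc k (v * c)) /\
  clos_refl_trans P (section_adj (fc a c) (fc b c)) (fc k (v * c)) (fc a.+1 c).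
Proof.
move=> ab bm Sv.
have adj w k l : par (fun k => a < k < b) w -> a < k < b -> a < l < b ->
    section_adj (fc a c) (fc b c) (fc k (w * c)) (fc l (w * c)).
  move=> Sw kab lab; have aw : fix_par a w by apply: par_itv_fix Sw _; lia.
  have bw : fix_par b w by apply: par_itv_fix Sw _; lia.
  split; [exact: fc_section_proper|exact: fc_section_proper|].
  by case: (leqP k l) => kl; [left|right]; apply: (fc_le_diag CG); lia.
pose Q w := par (fun k => a < k < b) w /\ forall k, a < k < b ->
  clos_refl_trans P (section_adj (fc a c) (fc b c)) (fc a.+1 c) (fc k (w * c)) /\
  clos_refl_trans P (section_adj (fc a c) (fc b c)) (fc k (w * c)) (fc a.+1 c).
suff [] : Q v by [].
apply: (par_indl SG (Q := Q)) Sv => [|j w jab [Sw IH]].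
  split=> [|k kab]; first exact: par1.
  have a1 : a < a.+1 < b by lia.
  have S1 := @par1 _ X (fun k => a < k < b).
  have := adj _ _ _ S1 a1 kab; have := adj _ _ _ S1 kab a1.
  by rewrite mul1g; split; apply: rt_step.
have SXw : par (fun k => a < k < b) (X j * w) by apply: parM => //; apply: par_gen.
split=> // k kab.
have [l lab lj] : exists2 l, a < l < b & l != j.
  by exists (if j == a.+1 then a.+2 else a.+1); case: (j =P a.+1); lia.
have e : fc l (X j * w * c) = fc l (w * c).
  apply/eq_fc; first lia.
  by rewrite -(mulgA (X j)) mulgK; apply: par_gen; rewrite eq_sym.
have [IH1 IH2] := IH l lab; rewrite -e in IH1 IH2.
by split; [apply: rt_trans IH1 _|apply: rt_trans _ IH2]; apply: rt_step; apply: adj.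
Qed.

Lemma tight_group_polytope : is_polytope P m.
Proof.
split.
- split; first exact: (geometry_poset SG CG).
    by move=> F; have [r [g [rm ->]]] := surj F; rewrite rank //; lia.
  exact: (geometry_rank_lt CG).
- have [_ anti _] := geometry_poset SG CG.
  split; [exists (fc 0 1)|exists (fc m.+1 1)].
    suff H F : fle (fc 0 1) F by split=> // F' F'F; apply: anti.
    have [r [g [rm ->]]] := surj F; apply/le_fc => //; split=> //.
    by exists g; rewrite mulgV; split; [apply: (fix_par_out SG)|apply: par1].
  suff H F : fle F (fc m.+1 1) by split=> // F' F'F; apply: anti.
  have [r [g [rm ->]]] := surj F; apply/le_fc => //; split=> //.
  exists g; rewrite mulgV; split; first exact: par1.
  by apply: (fix_par_out SG); lia.
- by move=> C /(base_flagP SG CG)[g ->]; exact: (card_base_flag CG).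
- move=> F F'; have [a [g [am ->]]] := surj F; have [b [h [bm ->]]] := surj F'.
  move=> /(fc_le_common CG am bm)[ab [c [-> ->]]].
  rewrite /section_connected !rank //.
  case: (ltnP a.+2 b) => ab2; [right|left; lia].
  move=> H K /(section_proper_fc ab bm)[k [y [kab /C1[u [v [Bu Sv ->]]] ->]]].
  move=> /(section_proper_fc ab bm)[k' [y' [kab' /C1[u' [v' [Bu' Sv' ->]]] ->]]].
  have km : k <= m.+1 by lia.
  have km' : k' <= m.+1 by lia.
  rewrite -!mulgA (fc_stab _ Bu km) (fc_stab _ Bu' km').
  have [_ H1] := connected_interval c ab2 bm Sv kab.
  have [H2 _] := connected_interval c ab2 bm Sv' kab'.
  exact: rt_trans H1 H2.
- move=> F F'; have [a [g [am ->]]] := surj F; have [b [h [bm ->]]] := surj F'.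
  move=> /(fc_le_common CG am bm)[ab [c [-> ->]]].
  rewrite !rank // => e; have {}e : b = a.+2 by lia.
  rewrite {}e in ab bm *; apply/card_I2P.
  have am1 : 0 < a.+1 <= m by lia.
  exists (fc a.+1 c), (fc a.+1 (X a.+1 * c)); split.
    move/esym/eq_fc; rewrite mulgK => H; apply: (TH.1 _ am1); apply: H; lia.
  apply/seteqP; split=> [H|H [->|->]].
  + move=> /(section_proper_fc ab bm)[k [y [kab fy ->]]].
    have -> : k = a.+1 by lia.
    have [r ra|By|By] := TH.2 _ y am1; first by apply: fy; lia.
      by left; apply: fc_stab => //; lia.
    by right; rewrite -[y](genK SG a.+1) -mulgA; apply: fc_stab => //; lia.
  + rewrite -[in fc a.+1 c](mul1g c); apply: fc_section_proper => //.
    - by lia.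
    - exact: par1.
    - exact: par1.
  + by apply: fc_section_proper; [lia| |apply: par_gen; lia|apply: par_gen; lia].
Qed.

Lemma tight_group_orientably_regular : is_orientably_regular P m.
Proof.
split; first exact: (geometry_regular SG CG).
exists (base_flag 1), (fun j => translation CG (X j.+1)).
have H : base_reflections m (base_flag 1) (fun j => translation CG (X j.+1)).
  move=> j jm; rewrite image_base_flag mul1g; split.
  - by apply/(base_flagP SG CG); exists 1.
  - by apply/(base_flagP SG CG); eexists.
  - move=> /(base_flag_eq SG CG) B; apply: (TH.1 j.+1); first lia.
    by have := B j.+1; rewrite mul1g (genV SG).
  - move=> F; have [r [g [rm ->]]] := surj F; rewrite rank // => rj.
    have rj' : r <> j.+1 by move=> e; apply: rj; rewrite e; lia.
    have e : fc r 1 = fc r (X j.+1).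
      by apply/eq_fc => //; rewrite mul1g (genV SG); apply: par_gen; lia.
    split=> -[s sm e']; exists r => //; have es := fc_index CG rm sm e';
      by rewrite e' -es e.
split=> //; first by apply/(base_flagP SG CG); exists 1.
exact: (rotation_index2 SG CG TH (ltn0Sn _) H).2 C5.
Qed.

Lemma tight_group_tight : is_tight P p.
Proof.
rewrite /is_tight; apply: card_eq_trans (card_flags SG CG) _.
by case: TG.
Qed.

End Sufficiency.

End TightCosetGeometry.

(** * Sections of rank 2 as polygons *)

Section Polygons.
Context (p : seq nat).
Local Notation m := (size p).+1.
Context (G : groupType) (X : nat -> G) (od : G -> bool).
Context (SG : string_group X m od).
Context (P : ranked_rel) (fc : nat -> G -> P) (CG : coset_geometry X m fc).
Context (j : nat) (jm : 0 < j <= size p).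
Implicit Types (g h u v c : G) (r s t k : nat).
Local Open Scope group_scope.
Local Open Scope classical_set_scope.
Local Open Scope card_scope.
Local Notation par := (par X).
Local Notation fix_par := (fix_par X).
Local Notation base_stab := (base_stab X).
Local Notation q := (entry p j).
Let sigma := X j * X j.+1.
Let eq_fc := fc_eq CG.

Lemma rotationV : sigma^-1 = X j.+1 * X j.
Proof. by rewrite invgM !(genV SG). Qed.

Lemma rotationV_mul s : sigma^-1 * sigma ^- s = sigma ^- s.+1.
Proof. by rewrite expgSr [RHS]invgM. Qed.

Lemma odd_rotation n : od (sigma ^+ n) = false.
Proof.
have ods : od sigma = false.
  by rewrite (strM SG) !(strX SG) //; lia.
by elim: n => [|n IH]; rewrite ?expg0 ?(str1 SG) // expgS (strM SG) ods IH.
Qed.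

Lemma fix_rotation k n : k != j -> k != j.+1 -> fix_par k (sigma ^+ n).
Proof.
move=> kj kj1; elim: n => [|n IH]; first exact: par1.
rewrite expgS; apply: parM => //; apply: parM; apply: par_gen; by rewrite eq_sym.
Qed.

Context (rotX : sigma ^+ q = 1) (q_gt0 : 0 < q).

Lemma rotation_mod s : sigma ^- s = sigma ^- (s %% q).
Proof.
by rewrite {1}(divn_eq s q) expgnDr mulnC expgnA rotX expg1n mul1g.
Qed.

Lemma mul_rotationV s : sigma * sigma ^- s = sigma ^- (s + q.-1).
Proof.
rewrite expgnDr invgM; congr (_ * _); apply/esym/mulg1_eq.
by rewrite -expgSr prednK.
Qed.

(** Inverse powers are chosen because the edge at [sigma ^- t] contains the vertices at [sigma ^- t]
    and [sigma ^- t.+1], as in [gon_le]; positive powers would run the polygon backwards. *)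
Lemma dihedral_par v : par (fun k => j.-1 < k < j.+2) v ->
  exists s, v = sigma ^- s \/ v = X j * sigma ^- s.
Proof.
apply: (par_indl SG (Q := fun v => exists s, v = sigma ^- s \/ v = X j * sigma ^- s)).
  by exists 0; left; rewrite expg0 invg1.
move=> k h /= kj [s e].
have /orP[/eqP -> | /eqP ->] : (k == j) || (k == j.+1) by lia.
  by exists s; case: e => ->; [right|left; rewrite mulgA (strXX SG) mul1g].
case: e => ->.
  exists (s + q.-1); right; rewrite -mul_rotationV /sigma !mulgA.
  by rewrite (strXX SG) mul1g.
by exists s.+1; left; rewrite mulgA -rotationV rotationV_mul.
Qed.

(** Modulo the stabilizer of a vertex or an edge, a reflection is a rotation: [X j] fixes the edge,
    and for the vertex [X j * sigma ^- s = X j.+1 * sigma ^- s.+1], where [X j.+1] fixes it. *)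
Lemma fc_dihedral k v c : j <= k <= j.+1 -> par (fun k => j.-1 < k < j.+2) v ->
  exists s, fc k (v * c) = fc k (sigma ^- s * c).
Proof.
move=> jk /dihedral_par[s [->|->]]; first by exists s.
have /orP[/eqP -> | /eqP ->] : (k == j) || (k == j.+1) by lia.
  exists s.+1; apply/eq_fc; first lia.
  have -> : X j * sigma ^- s = X j.+1 * sigma ^- s.+1.
    by rewrite -rotationV_mul rotationV !mulgA (strXX SG) mul1g.
  by rewrite -(mulgA (X j.+1)) mulgK; apply: par_gen; lia.
exists s; apply/eq_fc; first lia.
by rewrite -(mulgA (X j)) mulgK; apply: par_gen; lia.
Qed.

Section Sufficiency.
Context (TG : tight_group p X od).
Let C1 : interval_generated X. Proof. by case: TG. Qed.
Let C5 b : base_stab b -> ~~ od b. Proof. by case: TG => _ _ _; apply. Qed.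
Let TH : thin X m := tight_group_thin SG TG.

(** The power fixes every base face except possibly one, say of index [l]. By thinness it lies in
    [base_stab], possibly after multiplication by [X l], and parity excludes the latter. *)
Lemma fix_rotation_dvd k n : j <= k <= j.+1 -> fix_par k (sigma ^+ n) -> q %| n.
Proof.
move=> jk fk; case: TG => _ _ C4 _; apply: C4 => //.
pose l := if k == j then j.+1 else j.
have lm : 0 < l <= m by rewrite /l; case: eqP; lia.
have fl r : r != l -> fix_par r (sigma ^+ n).
  move=> rl; case: (eqVneq r k) => [-> //|rk]; apply: fix_rotation.
    by move: rl rk; rewrite /l; case: (k =P j); lia.
  by move: rl rk; rewrite /l; case: (k =P j); lia.
case: (TH.2 _ _ lm fl) => // /C5.
by rewrite (strM SG) odd_rotation (strX SG).
Qed.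

Lemma fc_rotation_eq k s t c : j <= k <= j.+1 ->
  fc k (sigma ^- s * c) = fc k (sigma ^- t * c) <-> s = t %[mod q].
Proof.
move=> jk; have km : k <= m.+1 by lia.
split=> [|e]; last by rewrite rotation_mod e -rotation_mod.
wlog st : s t / s <= t => [H e|].
  case/orP: (leq_total s t) => st; first exact: H.
  exact/esym/H.
move=> /eq_fc -/(_ km); rewrite invgM invgK !mulgA mulgK -(subnKC st) expgnDr mulKg.
move=> /(fix_rotation_dvd jk) d.
by rewrite -{1}[s]addn0; apply/eqP; rewrite eqn_modDl mod0n eq_sym.
Qed.

Lemma fc_rotation_le s t c : fle (fc j (sigma ^- s * c)) (fc j.+1 (sigma ^- t * c)) <->
  s = t %[mod q] \/ s = t.+1 %[mod q].
Proof.
have j1m : j.+1 <= m.+1 by lia.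
have j_m : j <= m.+1 by lia.
split=> [le|[e|e]]; last 2 first.
- have -> : fc j (sigma ^- s * c) = fc j (sigma ^- t * c) by apply/fc_rotation_eq; [lia|].
  exact: (fc_le_diag CG).
- have -> : fc j (sigma ^- s * c) = fc j (sigma ^- t.+1 * c) by apply/fc_rotation_eq; [lia|].
  have -> : fc j.+1 (sigma ^- t * c) = fc j.+1 (X j * sigma ^- t * c).
    apply/eq_fc => //; apply: (subgroup_divC (par_subgroup _ _)).
    by rewrite -(mulgA (X j)) mulgK; apply: par_gen; lia.
  have -> : fc j (sigma ^- t.+1 * c) = fc j (X j * sigma ^- t * c).
    apply/eq_fc => //; apply: (subgroup_divC (par_subgroup _ _)).
    have -> : X j * sigma ^- t = X j.+1 * sigma ^- t.+1.
      by rewrite -rotationV_mul rotationV !mulgA (strXX SG) mul1g.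
    by rewrite -(mulgA (X j.+1)) mulgK; apply: par_gen; lia.
  exact: (fc_le_diag CG).
have j2m : j.+2 <= m.+1 by lia.
(* Both edges lie under the same face of index [j.+2]. Hence they differ by some [y] fixing all
   faces but the edge, and thinness leaves two edges at a vertex. *)
have fj2 : fc j.+2 (sigma ^- s * c) = fc j.+2 (sigma ^- t * c).
  apply/eq_fc => //; rewrite invgM invgK !mulgA mulgK.
  by apply: parM; [apply: parV|]; apply: fix_rotation; lia.
have [|y [Ry Ly e]] := fc_le_both SG CG (ltnSn j) (ltnSn j.+1) j2m le.
  by rewrite fj2; apply: (fc_le_diag CG).
have fy r : r != j.+1 -> fix_par r y.
  by move=> rj; apply: (fix_outside Ry Ly); lia.
have j1 : 0 < j.+1 <= m by lia.
have jj1 : j <= j.+1 <= j.+1 by lia.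
case: (TH.2 _ _ j1 fy) => By.
  move: e; rewrite (fc_stab CG _ By) // => /(fc_rotation_eq _ _ _ jj1) e.
  by left.
right; move: e; rewrite -[y](genK SG j.+1) -mulgA (fc_stab CG _ By) //.
have -> : fc j.+1 (X j.+1 * (sigma ^- s * c)) = fc j.+1 (sigma ^- (s + q.-1) * c).
  apply/eq_fc => //; have -> : X j.+1 * (sigma ^- s * c) = X j * (sigma ^- (s + q.-1) * c).
    by rewrite -mul_rotationV /sigma !mulgA (strXX SG) mul1g.
  by rewrite mulgK; apply: par_gen; lia.
move=> /(fc_rotation_eq _ _ _ jj1) e.
by rewrite -addn1 -modnDml e modnDml -addnA addn1 prednK // modnDr.
Qed.

Lemma fc_face_cover c H : is_section (fc j.-1 c) (fc j.+2 c) H ->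
  [\/ H = fc j.-1 c, H = fc j.+2 c |
    exists k s, j <= k <= j.+1 /\ H = fc k (sigma ^- s * c)].
Proof.
have j2m : j.+2 <= m.+1 by lia.
have j0m : j.-1 <= j.+2 by lia.
move=> Hsec; have [le1 le2] := Hsec.
have [->|ne1] := pselect (fc j.-1 c = H); first by constructor 1.
have [->|ne2] := pselect (H = fc j.+2 c); first by constructor 2.
have lt : section_proper (fc j.-1 c) (fc j.+2 c) H by [].
have [k [y [ky fy ->]]] := section_proper_fc SG CG j0m j2m lt.
have [u [v [Bu Sv ->]]] := C1 fy.
constructor 3; exists k.
have jk : j <= k <= j.+1 by lia.
have km : k <= m.+1 by lia.
have [s e] := fc_dihedral c jk Sv.
by exists s; split=> //; rewrite -mulgA (fc_stab CG _ Bu).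
Qed.

Lemma section_gon c : section_is_gon q (fc j.-1 c) (fc j.+2 c).
Proof.
have j2m : j.+2 <= m.+1 by lia.
have j0m : j.-1 <= m.+1 by lia.
pose f (a : gon_face q) := match a with
  | gon_least => fc j.-1 c
  | gon_vertex i => fc j (sigma ^- i * c)
  | gon_edge i => fc j.+1 (sigma ^- i * c)
  | gon_greatest => fc j.+2 c
  end.
have le_lr a b g h : b < a -> a <= m.+1 -> fle (fc a g) (fc b h) <-> false.
  move=> ba am; split=> // le.
  have bm : b <= m.+1 by lia.
  by have [] := fc_le_common CG am bm le; lia.
have fix0 s : fc j.-1 (sigma ^- s * c) = fc j.-1 c.
  by apply/eq_fc => //; rewrite mulgK; apply: parV; apply: fix_rotation; lia.
have fix3 s : fc j.+2 (sigma ^- s * c) = fc j.+2 c.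
  by apply/eq_fc => //; rewrite mulgK; apply: parV; apply: fix_rotation; lia.
have least a : fle (fc j.-1 c) (f a).
  case: a => [|i|i|]; last by apply: (fc_le_diag CG); lia.
  - by apply: (fc_le_diag CG).
  - by rewrite -(fix0 i); apply: (fc_le_diag CG); lia.
  - by rewrite -(fix0 i); apply: (fc_le_diag CG); lia.
have greatest a : fle (f a) (fc j.+2 c).
  case: a => [|i|i|]; first by apply: (fc_le_diag CG); lia.
  - by rewrite -(fix3 i); apply: (fc_le_diag CG); lia.
  - by rewrite -(fix3 i); apply: (fc_le_diag CG); lia.
  - by apply: (fc_le_diag CG).
have same k s t : j <= k <= j.+1 ->
    fle (fc k (sigma ^- s * c)) (fc k (sigma ^- t * c)) <-> s = t %[mod q].
  move=> jk; have km : k <= m.+1 by lia.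
  split=> [/(fc_le_same CG km)/(fc_rotation_eq _ _ _ jk)//|/(fc_rotation_eq _ _ c jk) ->].
  exact: (fc_le_diag CG).
have fle_f a b : fle (f a) (f b) <-> gon_le a b.
  case: a b => [|i|i|] [|i'|i'|] //=; try (by apply: le_lr; lia).
  - by split=> // _; apply: (least (gon_least q)).
  - by split=> // _; apply: (least (gon_vertex i')).
  - by split=> // _; apply: (least (gon_edge i')).
  - by split=> // _; apply: (least (gon_greatest q)).
  - rewrite same; last lia.
    rewrite !modn_small //; split=> [/val_inj ->|/eqP ->]//.
  - rewrite fc_rotation_le; split=> [[|]|/orP[|]/eqP ->].
    + by rewrite !modn_small // => /val_inj ->; rewrite eqxx.
    + rewrite modn_small // => e; apply/orP; right; apply/eqP/val_inj.
      by rewrite /= e.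
    + by left.
    + by right; rewrite /= modn_mod.
  - by split=> // _; apply: (greatest (gon_vertex i)).
  - rewrite same; last lia.
    rewrite !modn_small //; split=> [/val_inj ->|/eqP ->]//.
  - by split=> // _; apply: (greatest (gon_edge i)).
  - by split=> // _; apply: (greatest (gon_greatest q)).
exists f; split=> //; split=> [a _|a b _ _ e|H].
- by split; [apply: least|apply: greatest].
- have [refl _ _] := geometry_poset SG CG.
  have ab : gon_le a b by apply/fle_f; rewrite e.
  have ba : gon_le b a by apply/fle_f; rewrite e.
  by case: a b ab ba {e} => [|i|i|] [|i'|i'|] //= /eqP ->.
- move=> /fc_face_cover[->|->|[k [s [jk ->]]]].
  + by exists (gon_least q).
  + by exists (gon_greatest q).
  + have /orP[/eqP -> | /eqP ->] : (k == j) || (k == j.+1) by lia.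
      exists (gon_vertex (Ordinal (ltn_pmod s q_gt0))) => //.
      by rewrite /= -rotation_mod.
    exists (gon_edge (Ordinal (ltn_pmod s q_gt0))) => //.
    by rewrite /= -rotation_mod.
Qed.

End Sufficiency.
End Polygons.

(** * From polytopes back to groups *)

Section Necessity.
Context (p : seq nat).
Local Notation m := (size p).+1.
Context (G : groupType) (X : nat -> G) (od : G -> bool).
Context (SG : string_group X m od).
Context (P : ranked_rel) (fc : nat -> G -> P) (CG : coset_geometry X m fc).
Context (rotX : forall j, 0 < j <= size p -> ((X j * X j.+1) ^+ entry p j = 1)%g).
Context (p_gt0 : forall j, 0 < j <= size p -> 0 < entry p j).
Implicit Types (g h u v c : G) (r s k : nat).
Local Open Scope group_scope.
Local Open Scope classical_set_scope.
Local Open Scope card_scope.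
Local Notation par := (par X).
Local Notation fix_par := (fix_par X).
Local Notation base_stab := (base_stab X).
Local Notation base_flag := (base_flag m fc).
Let surj := fc_surj CG.
Let rank := fc_rank CG.
Let eq_fc := fc_eq CG.

Section Polytope.
Context (PP : is_polytope P m).

Lemma polytope_diamond k : 0 < k <= m ->
  exists a b, a <> b /\ section_proper (fc k.-1 1) (fc k.+1 1) = [set a; b].
Proof.
move=> km; case: PP => _ _ _ _ D; apply/card_I2P/D.
  by apply: (fc_le_diag CG); lia.
by rewrite !rank; lia.
Qed.

(** If [X k] lay in [fix_par k], that subgroup would be the whole group and there would be one face
    of index [k], not two. For the second half, [fc k 1], [fc k (X k)] and [fc k g] lie in a
    two-element set and the first two differ. *)
Lemma polytope_thin : thin X m.
Proof.
have C2 k : 0 < k <= m -> ~ fix_par k (X k).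
  move=> km fX; have [a [b [ab e]]] := polytope_diamond km.
  have fT g : fix_par k g.
    apply: (par_indl SG (Q := fix_par k)) (strT SG g) => [|l h _ fh]; first exact: par1.
    apply: parM => //; case: (eqVneq l k) => [->//|lk]; exact: par_gen.
  have fcE F : section_proper (fc k.-1 1) (fc k.+1 1) F -> F = fc k 1.
    have kk : k.-1 <= k.+1 by lia.
    have km1 : k.+1 <= m.+1 by lia.
    move=> /(section_proper_fc SG CG kk km1)[l [y [lk _ ->]]].
    by have -> : l = k by [lia]; apply/eq_fc; [lia|apply: fT].
  by case: ab; transitivity (fc k 1); [|symmetry]; apply: fcE; rewrite e; [left|right].
split=> // k g km fg; have [a [b [ab e]]] := polytope_diamond km.
have km1 : k <= m.+1 by lia.
have inS y : (forall r, r != k -> fix_par r y) -> [set a; b] (fc k y).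
  move=> fy; rewrite -e -[y]mulg1; apply: (fc_section_proper CG); try lia.
    by apply: fy; lia.
  by apply: fy; lia.
have fX r : r != k -> fix_par r (X k) by move=> rk; apply: par_gen; rewrite eq_sym.
have S1 := inS 1 (fun _ _ => @par1 _ X _).
have SX := inS _ fX.
have Sg := inS _ fg.
have ne : fc k 1 <> fc k (X k).
  by move=> /esym/eq_fc; rewrite invg1 mulg1 => /(_ km1); apply: C2.
have [eg|eg] : fc k g = fc k 1 \/ fc k g = fc k (X k).
- by move: S1 SX Sg ne => [->|->] [->|->] [->|->]; tauto.
- left=> r; case: (eqVneq r k) => [->|]; last exact: fg.
  by move/eq_fc: eg; rewrite invg1 mulg1; apply.
right=> r; case: (eqVneq r k) => [->|rk].
  by move/eq_fc: eg; rewrite (genV SG); apply.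
by apply: parM; [apply: fg|apply: fX].
Qed.
Let TH := polytope_thin.

(* Induction on the length of the interval: a path of incident proper faces of
   the section from [fc a.+1 1] to [fc a.+1 g] exists by connectedness, and each
   step is realized by an element of a shorter interval subgroup. *)
Lemma polytope_interval_generated : interval_generated X.
Proof.
have BM u v : base_stab u -> base_stab v -> base_stab (u * v).
  by case: (base_stab_subgroup X) => _ + _; apply.
suff H n a b g : b - a <= n -> b <= m.+1 -> (forall r, ~~ (a < r < b) -> fix_par r g) ->
    exists u v, [/\ base_stab u, par (fun k => a < k < b) v & g = u * v].
  move=> a b g fg.
  (* Above index [m] the subgroup [fix_par r] is everything, so cutting the interval at [m.+1] loses
     nothing. *)
  have [||u [v [Bu Sv ->]]] := H (minn b m.+1) a (minn b m.+1) g (leq_subr _ _).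
  - exact: geq_minr.
  - move=> r rb; case: (ltnP m r) => rm; first by apply: (fix_par_out SG); lia.
    by apply: fg; lia.
  by exists u, v; split=> //; apply: par_sub Sv => k; lia.
elim: n a b g => [|n IH] a b g abn bm fg.
  exists g, 1; rewrite mulg1; split=> //; last exact: par1.
  by move=> r; apply: fg; lia.
case: (leqP b a.+1) => ab1.
  exists g, 1; rewrite mulg1; split=> //; last exact: par1.
  by move=> r; apply: fg; lia.
case: (leqP b a.+2) => ab2.
  have am : 0 < a.+1 <= m by lia.
  case: (TH.2 _ g am) => [r ra|Bg|Bg]; first by apply: fg; lia.
    by exists g, 1; rewrite mulg1; split=> //; exact: par1.
  exists (g * X a.+1), (X a.+1); rewrite (genK SG); split=> //.
  by apply: par_gen; lia.
have ab : a <= b by lia.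
have a1ab : a < a.+1 < b by lia.
have fgS : section_proper (fc a 1) (fc b 1) (fc a.+1 g).
  by rewrite -[X in fc a.+1 X]mulg1; apply: (fc_section_proper CG) => //; apply: fg; lia.
have f1S : section_proper (fc a 1) (fc b 1) (fc a.+1 1).
  by rewrite -[X in fc a.+1 X]mulg1; apply: (fc_section_proper CG) => //; exact: par1.
have [le|conn] : section_connected (fc a 1) (fc b 1).
- by case: PP => _ _ _ + _; apply; apply: (fc_le_diag CG).
- by move: le; rewrite !rank; lia.
have {conn f1S fgS} path := conn _ _ f1S fgS.
pose Q F := exists k h, [/\ a < k < b, par (fun k => a < k < b) h & F = fc k h].
have Qstep F F' : section_adj (fc a 1) (fc b 1) F F' -> Q F -> Q F'.
  move=> [_ F'S inc] [k [h [kab Sh e]]].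
  have [l [y [lab fy e']]] := section_proper_fc SG CG ab bm F'S.
  rewrite mulg1 in e'; rewrite {}e {}e' in inc F'S *.
  have fa : fc a 1 = fc a h.
    apply/esym/eq_fc; first lia; rewrite invg1 mulg1.
    by apply: par_itv_fix Sh _; lia.
  have fb : fc b 1 = fc b h.
    apply/esym/eq_fc; first lia; rewrite invg1 mulg1.
    by apply: par_itv_fix Sh _; lia.
  have [km lm] : k <= m.+1 /\ l <= m.+1 by lia.
  have move_to (a1 b1 : nat) z : a <= a1 -> b1 <= b -> b1 - a1 <= n -> a1 < l < b1 ->
      par (fun k => a1 < k) z -> par (fun k => k < b1) z ->
      fc l y = fc l (z * h) -> Q (fc l y).
    move=> aa1 b1b len la1b1 Rz Lz ->.
    have [|u [v [Bu Sv ->]]] := IH a1 b1 z len _ (fix_outside Rz Lz); first lia.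
    exists l, (v * h); split=> //; last by rewrite -mulgA (fc_stab CG _ Bu).
    by apply: parM => //; apply: par_sub Sv => i; lia.
  case: (ltngtP k l) => kl.
  - have le : fle (fc k h) (fc l y).
      by case: inc => // /(fc_le_common CG lm km)[]; lia.
    have lb : l < b by lia.
    rewrite fb in F'S; have [z [Rz Lz e]] := fc_le_both SG CG kl lb bm le F'S.2.1.
    by apply: (move_to k b z) e => //; lia.
  - have le : fle (fc l y) (fc k h).
      by case: inc => // /(fc_le_common CG km lm)[]; lia.
    have al : a < l by lia.
    rewrite fa in F'S; have [z [Rz Lz e]] := fc_le_both SG CG al kl km F'S.1.1 le.
    by apply: (move_to a k z) e => //; lia.
  - exists k, h; split=> //; rewrite -kl in inc *.
    by case: inc => /(fc_le_same CG km) ->.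
have : Q (fc a.+1 g).
  have : Q (fc a.+1 1) by exists a.+1, 1; split=> //; exact: par1.
  elim: path => [F F' /Qstep|F|F F' F'' _ IH1 _ IH2 /IH1/IH2] //; exact.
move=> [k [h [kab Sh e]]].
have km : k <= m.+1 by lia.
have am1 : a.+1 <= m.+1 by lia.
have ak := fc_index CG am1 km e.
have {e} fk : fix_par k (g * h^-1) by apply/eq_fc => //; rewrite -{1}ak.
have fgh r : ~~ (a < r < b) || (r == k) -> fix_par r (g * h^-1).
  case: (eqVneq r k) => [->//|_]; rewrite orbF => rab.
  by apply: parF; [apply: fg|apply: par_itv_fix Sh _].
(* Since [k = a.+1], the lower factor [u] fixes the whole base flag, and the upper factor [v] falls
   to the induction hypothesis on the shorter interval from [k] to [b]. *)
have [u [v [Lu Rv e]]] := fix_par_split SG fk.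
have Bu : base_stab u.
  move=> r; case: (ltnP r k) => rk; last exact: par_lt_fix Lu rk.
  have -> : u = (g * h^-1) * v^-1 by rewrite e mulgK.
  apply: parF; last by apply: par_gt_fix Rv _; exact: ltnW.
  by apply: fgh; lia.
have fv r : ~~ (k < r < b) -> fix_par r v.
  case: (leqP r k) => rk rkb; first exact: par_gt_fix Rv rk.
  have -> : v = u^-1 * (g * h^-1) by rewrite e mulKg.
  by apply: parM; [exact: parV (Bu r)|apply: fgh; lia].
have [||w [z [Bw Sz ev]]] := IH k b v _ _ fv; [lia|lia|].
exists (u * w), (z * h); split; first exact: BM.
  by apply: parM => //; apply: par_sub Sz => i; lia.
by rewrite -[g](mulgVK h) e ev !mulgA.
Qed.

End Polytope.

Lemma tight_polytope_group :
  tight_orientably_regular_polytope P p -> tight_group p X od.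
Proof.
move=> [PP [reg [Phi [rho [/(base_flagP SG CG)[phi ->] refl ind]]]] ty ti].
have TH := polytope_thin PP.
have C1 := polytope_interval_generated PP.
split=> //.
- by apply: card_eq_trans ti; rewrite card_eq_sym; exact: (card_flags SG CG).
- move=> j t jm Bt; set q := entry p j; set sg := X j * X j.+1 in Bt *.
  have q0 : 0 < q by apply: p_gt0.
  have rot : sg ^+ q = 1 by apply: rotX.
  case: (posnP (t %% q)) => [/eqP//|t0].
  (* Otherwise the rotation power of exponent [t %% q], positive and below [q], fixes the base flag.
     Vertices of the section then depend only on an exponent modulo [t %% q], too few for a
     [q]-gon. *)
  exfalso.
  have Bt' : base_stab (sg ^+ (t %% q)).
    by move: Bt; rewrite {1}(divn_eq t q) expgnDr mulnC expgnA rot expg1n mul1g.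
  have j2m : j.+2 <= m.+1 by lia.
  have j0m : j.-1 <= m.+1 by lia.
  have j_m : j <= m.+1 by lia.
  have jj : j.-1 <= j.+2 by lia.
  have [] := ty j jm (fc j.-1 1) (fc j.+2 1).
  - by rewrite rank //; lia.
  - by rewrite rank //; lia.
  - exact: (fc_le_diag CG).
  move=> f [[fS finj _] fle_f].
  have f_lt a b : gon_le a b -> a <> b -> flt (f a) (f b).
    move=> ab ne; split; first exact/fle_f.
    by move/finj; rewrite !inE => /(_ Logic.I Logic.I).
  have fv (i : 'I_q) : exists s : 'I_(t %% q), f (gon_vertex i) = fc j (sg ^- s).
    have lt1 : flt (f (gon_least q)) (f (gon_vertex i)) by apply: f_lt.
    have lt2 : flt (f (gon_vertex i)) (f (gon_edge i)).
      by apply: f_lt => //=; rewrite eqxx.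
    have lt3 : flt (f (gon_edge i)) (f (gon_greatest q)) by apply: f_lt.
    have [le0 _] := fS (gon_least q) Logic.I.
    have [_ le4] := fS (gon_greatest q) Logic.I.
    have Sv := fS (gon_vertex i) Logic.I.
    (* The polygon isomorphism [f] says nothing about ranks. The strict chain least, vertex, edge,
       greatest squeezed between indices [j.-1] and [j.+2] forces index [j] on the vertex. *)
    have [r0 [g0 [r0m e0]]] := surj (f (gon_least q)).
    have [r1 [g1 [r1m e1]]] := surj (f (gon_vertex i)).
    have [r2 [g2 [r2m e2]]] := surj (f (gon_edge i)).
    have [r3 [g3 [r3m e3]]] := surj (f (gon_greatest q)).
    rewrite {}e0 {}e1 {}e2 {}e3 in lt1 lt2 lt3 le0 le4 Sv *.
    have l1 := fc_lt CG r0m r1m lt1; have l2 := fc_lt CG r1m r2m lt2.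
    have l3 := fc_lt CG r2m r3m lt3.
    have [l0 _] := fc_le_common CG j0m r0m le0.
    have [l4 _] := fc_le_common CG r3m j2m le4.
    have r1j : r1 = j by lia.
    rewrite {}r1j in Sv *.
    have jm1 : j.-1 < j by lia.
    have [y [Ry Ly ->]] := fc_le_both SG CG jm1 (leqW (ltnSn j)) j2m Sv.1 Sv.2.
    have [u [v [Bu Sv' ->]]] := C1 _ _ _ (fix_outside Ry Ly).
    have jj1 : j <= j <= j.+1 by lia.
    have [s es] := fc_dihedral SG CG jm rot q0 1 jj1 Sv'.
    exists (Ordinal (ltn_pmod s t0)) => /=.
    rewrite -mulgA (fc_stab CG _ Bu) // es mulg1.
    have -> : sg ^- s = (sg ^+ (t %% q) ^+ (s %/ (t %% q)))^-1 * sg ^- (s %% (t %% q)).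
      rewrite -invgM -expgnA -expgnDr; congr (_ ^+ _)^-1.
      by rewrite addnC mulnC -divn_eq.
    rewrite (fc_stab CG) //.
    have [B1 BM BV] := base_stab_subgroup X; apply: BV.
    by elim: (s %/ _) => [|l IH]; rewrite ?expg0 // expgS; apply: BM.
  have [F FE] := choice fv.
  have Finj : injective F.
    move=> i i' e; have : f (gon_vertex i) = f (gon_vertex i') by rewrite !FE e.
    by move/finj; rewrite !inE => /(_ Logic.I Logic.I)[].
  have := leq_card F Finj; rewrite !card_ord.
  by have := ltn_pmod t q0; lia.
- exact: (rotation_index2 SG CG TH (ltn0Sn _) refl).1 ind.
Qed.

Lemma tight_group_polytopeP :
  tight_orientably_regular_polytope P p <-> tight_group p X od.
Proof.
split; first exact: tight_polytope_group.
move=> TG; split.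
- exact: (tight_group_polytope SG CG TG).
- exact: (tight_group_orientably_regular SG CG TG).
- move=> j jm F F'; have [r [g [rm ->]]] := surj F; have [s [h [sm ->]]] := surj F'.
  rewrite !rank // => er es; have {}er : r = j.-1 by lia.
  have {}es : s = j.+2 by lia.
  rewrite {}er {}es in rm sm * => /(fc_le_common CG rm sm)[_ [c [-> ->]]].
  exact: (section_gon SG CG jm (rotX jm) (p_gt0 jm) TG).
- exact: (tight_group_tight SG CG TG).
Qed.

End Necessity.

(** * The presented groups *)

Section GammaPresentation.
Context (p : seq nat).
Local Notation m := (size p).+1.
Local Open Scope group_scope.
Local Open Scope classical_set_scope.
Local Open Scope quotient_scope.
Local Notation rel := (@Gamma_relator p).

(** The defining relations read in [H], with [f k] in the place of [x_(k-1)]; words associate to the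
    right as the evaluation of a concatenation does. *)
Record Gamma_spec (H : groupType) (f : nat -> H) : Prop := GammaSpec {
  spec_inv : forall j, j <= size p -> f j.+1 ^+ 2 = 1;
  spec_rot : forall j, 0 < j <= size p -> (f j * f j.+1) ^+ entry p j = 1;
  spec_comm : forall j k, j <= size p -> k <= size p ->
    (j.+2 <= k) || (k.+2 <= j) -> (f j.+1 * f k.+1) ^+ 2 = 1;
  spec_ee : forall j, 0 < j -> j < size p ->
    ~~ odd (entry p j) -> ~~ odd (entry p j.+1) ->
    (f j * (f j.+1 * (f j.+2 * f j.+1))) ^+ 2 = 1;
  spec_oe : forall j, 0 < j -> j < size p ->
    odd (entry p j) -> ~~ odd (entry p j.+1) ->
    (f j * (f j.+1 * (f j.+2 * (f j.+1 * f j.+2)))) ^+ 2 = 1;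
  spec_eo : forall j, 0 < j -> j < size p ->
    ~~ odd (entry p j) -> odd (entry p j.+1) ->
    (f j.+2 * (f j.+1 * (f j * (f j.+1 * f j)))) ^+ 2 = 1
}.

Definition Gamma_pi (w : word 'I_m) : Gamma p := \pi_(presented rel) w.

Lemma Gamma_pi_cat u v : Gamma_pi (u ++ v) = Gamma_pi u * Gamma_pi v.
Proof. by rewrite /Gamma_pi -pres_mul_pi. Qed.

Lemma Gamma_pi_exp w k : Gamma_pi (word_exp w k) = Gamma_pi w ^+ k.
Proof.
elim: k => // k IH; rewrite expgS -IH -Gamma_pi_cat.
by [].
Qed.

(** [genX k] is the generator [x_(k-1)]; the shift frees index 0 for the value 1, where truncated
    subtraction will land. *)
Definition genX (k : nat) : Gamma p := if 0 < k <= m then Gamma_gen (inord k.-1) else 1.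

Lemma Gamma_pi_gen j : j <= size p -> Gamma_pi (gen_word p j) = genX j.+1.
Proof. by move=> jm; rewrite /genX ifT. Qed.

Lemma relator1 r : rel r -> Gamma_pi r = 1.
Proof.
move=> Rr; apply/presented_eqP; apply: rst_step.
by have := step_relator [::] [::] Rr; rewrite cats0.
Qed.

Lemma genX_spec : Gamma_spec genX.
Proof.
have jP j : 0 < j -> j.-1.+1 = j by case: j.
split=> [j jm|j jm|j k jm km jk|j j0 jm ev ev'|j j0 jm ev ev'|j j0 jm ev ev'].
- by have := relator1 (relator_involution jm); rewrite Gamma_pi_exp Gamma_pi_gen.
- have := relator1 (relator_rotation jm); rewrite Gamma_pi_exp Gamma_pi_cat.
  by rewrite !Gamma_pi_gen ?jP //; lia.
- by have := relator1 (relator_commute jm km jk); rewrite Gamma_pi_exp Gamma_pi_cat !Gamma_pi_gen.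
- have := relator1 (relator_even_even j0 jm ev ev'); rewrite Gamma_pi_exp !Gamma_pi_cat.
  by rewrite !Gamma_pi_gen ?jP //; lia.
- have := relator1 (relator_odd_even j0 jm ev ev'); rewrite Gamma_pi_exp !Gamma_pi_cat.
  by rewrite !Gamma_pi_gen ?jP //; lia.
- have := relator1 (relator_even_odd j0 jm ev ev'); rewrite Gamma_pi_exp !Gamma_pi_cat.
  by rewrite !Gamma_pi_gen ?jP //; lia.
Qed.

Section Lift.
Context (H : groupType) (f : nat -> H) (fS : Gamma_spec f).

Definition word_eval (w : word 'I_m) : H :=
  foldr (fun (a : 'I_m * bool) h => (if a.2 then f a.1.+1 else (f a.1.+1)^-1) * h) 1 w.

Lemma word_eval_cat u v : word_eval (u ++ v) = word_eval u * word_eval v.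
Proof. by elim: u => [|a u IH] /=; rewrite ?mul1g // IH mulgA. Qed.

Lemma word_eval_exp w k : word_eval (word_exp w k) = word_eval w ^+ k.
Proof. by elim: k => // k IH; rewrite expgS -IH -word_eval_cat. Qed.

Lemma word_eval_gen j : j <= size p -> word_eval (gen_word p j) = f j.+1.
Proof. by move=> jm; rewrite /= mulg1 inordK. Qed.

Lemma word_eval_relator r : rel r -> word_eval r = 1.
Proof.
have jP j : 0 < j -> j.-1.+1 = j by case: j.
case=> [j jm|j jm|j k jm km jk|j j0 jm ev ev'|j j0 jm ev ev'|j j0 jm ev ev'];
  rewrite word_eval_exp ?word_eval_cat !word_eval_gen ?jP //; try lia.
- exact: spec_inv.
- exact: spec_rot.
- exact: spec_comm.
- exact: spec_ee.
- exact: spec_oe.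
- exact: spec_eo.
Qed.

Lemma word_eval_eq u v : word_eq rel u v -> word_eval u = word_eval v.
Proof.
move=> uv; elim: uv => {u v} [u v|u|u v _|u v w _ -> _ ->] //.
case=> [s t x b|s t r /word_eval_relator r1]; rewrite !word_eval_cat ?r1 ?mul1g //.
by case: b => /=; rewrite mulg1 ?mulgV ?mulVg mul1g.
Qed.

(** The universal property of the presentation. The range of [k] matters: outside it [genX k] is 1
    whereas [f k] is arbitrary. *)
Lemma Gamma_lift : exists phi : Gamma p -> H,
  (forall g h, phi (g * h) = phi g * phi h) /\
  (forall k, 0 < k <= m -> phi (genX k) = f k).
Proof.
have piE w : word_eval (repr (Gamma_pi w)) = word_eval w.
  exact/word_eval_eq/repr_pi_eq.
exists (fun g => word_eval (repr g)); split=> [g h|k km].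
  by rewrite -word_eval_cat -[RHS]piE Gamma_pi_cat /Gamma_pi !reprK.
have k1 : k.-1 <= size p by lia.
have kE : k.-1.+1 = k by lia.
by rewrite -kE -Gamma_pi_gen // piE word_eval_gen.
Qed.

End Lift.

Definition odd_elt (g : Gamma p) : bool := odd (size (repr g)).

(** Every relator has even length, being a square or a power of a two-letter word. *)
Lemma odd_word_eq u v : word_eq rel u v -> odd (size u) = odd (size v).
Proof.
have size_exp (w : word 'I_m) k : size (word_exp w k) = (k * size w)%N.
  by rewrite size_flatten /shape map_nseq sumn_nseq mulnC.
move=> uv; elim: uv => {u v} [u v|u|u v _|u v w _ -> _ ->] //.
case=> [s t x b|s t r Rr]; rewrite !size_cat !oddD //=.
suff -> : odd (size r) = false by [].
by case: Rr => *; rewrite size_exp ?size_cat oddM //= andbF.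
Qed.

Lemma odd_elt_pi w : odd_elt (Gamma_pi w) = odd (size w).
Proof. exact/odd_word_eq/repr_pi_eq. Qed.

Lemma Gamma_string_group : string_group genX m odd_elt.
Proof.
have XX k : genX k * genX k = 1.
  case: (boolP (0 < k <= m)) => km; last by rewrite /genX (negbTE km) mulg1.
  have kE : k.-1.+1 = k by lia.
  by rewrite -kE -expg2; apply: (spec_inv genX_spec); lia.
have XV k : (genX k)^-1 = genX k by apply/mulg1_eq/XX.
have out k : ~~ (0 < k <= m) -> genX k = 1 by move=> km; rewrite /genX (negbTE km).
have oM g h : odd_elt (g * h) = odd_elt g (+) odd_elt h.
  have {1}-> : g * h = Gamma_pi (repr g ++ repr h) by rewrite Gamma_pi_cat /Gamma_pi !reprK.
  by rewrite odd_elt_pi size_cat oddD.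
split=> // [j k jk|g|k km].
- case: (boolP (0 < j <= m)) => jm; last by rewrite (out j) // mulg1 mul1g.
  case: (boolP (0 < k <= m)) => km; last by rewrite (out k) // mulg1 mul1g.
  have kE : k.-1.+1 = k by lia.
  have jE : j.-1.+1 = j by lia.
  have : (genX j.-1.+1 * genX k.-1.+1) ^+ 2 = 1.
    by apply: (spec_comm genX_spec); lia.
  by rewrite jE kE expg2 => /mulg1_eq; rewrite invgM !XV.
- rewrite -[g]reprK -/(Gamma_pi _); elim: (repr g) => [|[x b] w IH]; first exact: par1.
  rewrite -cat1s Gamma_pi_cat; apply: parM => //.
  have Xx : Gamma_pi [:: (x, true)] = genX x.+1.
    by rewrite /genX ifT ?ltn_ord //= inord_val.
  case: b; rewrite ?Xx; first exact: par_gen.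
  suff -> : Gamma_pi [:: (x, false)] = genX x.+1 by exact: par_gen.
  rewrite -Xx -[RHS]invgK Xx XV -Xx; apply/esym/mulg1_eq; rewrite -Gamma_pi_cat.
  apply/presented_eqP/rst_step; exact: (@step_cancel _ rel [::] [::] x true).
- have k1 : k.-1 <= size p by lia.
  have kE : k.-1.+1 = k by lia.
  by rewrite -kE -Gamma_pi_gen // odd_elt_pi.
Qed.

Lemma Gamma_subE (j : 'I_m) : Gamma_sub j = fix_par genX j.+1.
Proof.
apply/seteqP; split; apply: generated_min; try exact: generated_subgroup.
  move=> _ [k kj <-]; have -> : Gamma_gen k = genX k.+1.
    by rewrite /genX ifT ?ltn_ord //= inord_val.
  apply: par_gen; by rewrite eqSS.
move=> _ [k /= kj <-]; rewrite /genX; case: ifP => km; last first.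
  by case: (generated_subgroup [set Gamma_gen k | k in [set k | k != j]]).
apply: generatedT; exists (inord k.-1) => //=; apply: contraNneq kj => /(congr1 val) /=.
by rewrite inordK; lia.
Qed.

Lemma face_coset_eq (j : 'I_m) A B pA pB : A = B ->
  @face_coset p j A pA = @face_coset p j B pB.
Proof. by move=> e; case: _ / e pB => pB; congr face_coset; apply: Prop_irrelevance. Qed.

Definition coset_at (r : nat) (g : Gamma p) : coset_poset p :=
  if r is r'.+1 then
    if insub r' is Some j then
      @face_coset p j (right_coset (Gamma_sub j) g) (ex_intro2 _ _ g Logic.I erefl)
    else @face_greatest p
  else @face_least p.

Lemma coset_at_in (j : 'I_m) g : coset_at j.+1 g =
  @face_coset p j (right_coset (Gamma_sub j) g) (ex_intro2 _ _ g Logic.I erefl).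
Proof. by rewrite /coset_at valK. Qed.

Lemma coset_at_greatest g : coset_at m.+1 g = @face_greatest p.
Proof. by rewrite /coset_at insubF // ltnn. Qed.

Lemma coset_atP (Q : nat -> Prop) : Q 0 -> (forall j : 'I_m, Q j.+1) -> Q m.+1 ->
  forall r, r <= m.+1 -> Q r.
Proof.
move=> Q0 Qj Qm [|r] // rm; move: rm; rewrite ltnS leq_eqVlt => /predU1P[->//|rm].
exact: (Qj (Ordinal rm)).
Qed.

Lemma Gamma_geometry : coset_geometry genX m coset_at.
Proof.
have fix_out := fix_par_out Gamma_string_group.
have sub_sg (j : 'I_m) : is_subgroup (Gamma_sub j) := generated_subgroup _.
have eq_coset (j : 'I_m) g h : coset_at j.+1 g = coset_at j.+1 h <-> fix_par genX j.+1 (g * h^-1).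
  rewrite -Gamma_subE -right_coset_eq // !coset_at_in; split=> [[]//|].
  exact: face_coset_eq.
split=> [F|r g|r s g h rm|r g h].
- case: F => [|j A HA|]; first by exists 0, 1.
    have [g _ e] := HA; exists j.+1, g; split; first by rewrite ltnS ltnW.
    by rewrite coset_at_in; apply: face_coset_eq.
  by exists m.+1, 1; rewrite coset_at_greatest.
- move: r; apply: coset_atP => [|j|]; first by [].
    by rewrite coset_at_in /=; lia.
  by rewrite coset_at_greatest /=; lia.
- have fixT t g' : t = 0 \/ t = m.+1 -> fix_par genX t g'.
    by move=> te; apply: fix_out; lia.
  move: r rm s; apply: coset_atP => [s|i|s]; last 1 first.
  + rewrite coset_at_greatest.
    move: s; apply: coset_atP => [|j|]; rewrite ?coset_at_in ?coset_at_greatest /=.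
    * by split=> // -[].
    * by split=> // -[]; have := ltn_ord j; lia.
    * by split=> // _; split=> //; exists 1; split; apply: fixT; right.
  + move=> sm; split=> // _; split=> //; exists h.
    by rewrite mulgV; split; [apply: fixT; left|exact: par1].
  apply: coset_atP => [|j|]; rewrite ?coset_at_in ?coset_at_greatest /=.
  + by split=> // -[].
  + rewrite -!Gamma_subE; split=> [[ij [c [/right_cosetP ic /right_cosetP jc]]]|[ij [c [ic jc]]]].
      by split=> //; exists c.
    by split=> //; exists c; split; apply/right_cosetP.
  + split=> // _; split; first by rewrite ltnS ltnW.
    by exists g; rewrite mulgV; split; [exact: par1|apply: fixT; right].
- move: r; apply: coset_atP => [|j|]; [| |]; last 2 first.
  + exact: eq_coset.
  + rewrite !coset_at_greatest; split=> // _; apply: fix_out; lia.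
  by split=> // _; apply: fix_out.
Qed.

End GammaPresentation.

(** * Group morphisms determined on generators *)

Section Morphisms.
Local Open Scope group_scope.

Definition group_morphism (G H : groupType) (f : G -> H) : Prop :=
  forall g h, f (g * h) = f g * f h.

Context (G H : groupType).
Implicit Types (f : G -> H) (g h : G).

Lemma morphism1 f : group_morphism f -> f 1 = 1.
Proof. by move=> fM; have := fM 1 1; rewrite mulg1 -{1}[f 1]mulg1 => /mulgI. Qed.

Lemma morphismV f : group_morphism f -> forall g, f g^-1 = (f g)^-1.
Proof. by move=> fM g; apply/esym/mulg1_eq; rewrite -fM mulgV morphism1. Qed.

Lemma morphismX f : group_morphism f -> forall g n, f (g ^+ n) = f g ^+ n.
Proof.
move=> fM g; elim=> [|n IH]; first by rewrite !expg0 morphism1.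
by rewrite !expgS fM IH.
Qed.

Context (X : nat -> G) (m : nat) (od : G -> bool) (SG : string_group X m od).

Lemma morphism_ext (f1 f2 : G -> H) : group_morphism f1 -> group_morphism f2 ->
  (forall k, f1 (X k) = f2 (X k)) -> f1 =1 f2.
Proof.
move=> f1M f2M e g; apply: (par_indl SG (Q := fun g => f1 g = f2 g)) (strT SG g).
  by rewrite !morphism1.
by move=> k h _ IH; rewrite f1M f2M e IH.
Qed.

Lemma morphism_par f (Y : nat -> H) (S T : nat -> bool) : group_morphism f ->
  (forall k, S k -> par Y T (f (X k))) -> forall g, par X S g -> par Y T (f g).
Proof.
move=> fM fX g; apply: (par_indl SG (Q := fun g => par Y T (f g))).
  by rewrite morphism1 //; exact: par1.
by move=> k h Sk IH; rewrite fM; apply: parM => //; apply: fX.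
Qed.

End Morphisms.

(** * Counting cosets by labels in finite types *)

Section CosetIndex.
Context (G : groupType) (B : set G) (sB : is_subgroup B).
Local Open Scope group_scope.
Local Open Scope classical_set_scope.
Local Open Scope card_scope.

Lemma coset_index n : right_cosets B #= `I_n -> exists f : G -> 'I_n,
  (forall g h, f g = f h <-> B (g * h^-1)) /\ forall x, exists g, f g = x.
Proof.
move=> /card_set_bijP[f [fn finj fsurj]].
have fB g : f (right_coset B g) < n by apply: fn; exists g.
exists (fun g => Ordinal (fB g)); split=> [g h|[x xn]].
  rewrite -right_coset_eq //; split=> [[] e|e]; last by apply: val_inj; rewrite /= e.
  by apply: finj e; rewrite inE; [exists g|exists h].
have [_ [g _ <-] fg] := fsurj x xn.
by exists g; apply: val_inj.
Qed.

Lemma card_coset_index (T : finType) (f : G -> T) (A : {set T}) :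
  (forall g h, f g = f h <-> B (g * h^-1)) ->
  (forall x, (x \in A) <-> exists g, f g = x) -> right_cosets B #= `I_#|A|.
Proof.
move=> fB fA.
have f1A : f 1 \in A by apply/fA; exists 1.
have /choice[rep repE] : forall x : T, exists g, x \in A -> f g = x.
  move=> x; case xA : (x \in A); last by exists 1.
  by have [g <-] := (fA x).1 xA; exists g.
pose x_ n := nth (f 1) (enum A) n.
have x_A n : n < #|A| -> x_ n \in A by move=> nA; rewrite -mem_enum mem_nth // -cardE.
have -> : right_cosets B = (fun n => right_coset B (rep (x_ n))) @` `I_#|A|.
  apply/seteqP; split=> [_ [g _ <-]|_ [n _ <-]]; last by exists (rep (x_ n)).
  have gA : f g \in A by apply/fA; exists g.
  exists (index (f g) (enum A)); first by rewrite /= cardE index_mem mem_enum.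
  by apply/right_coset_eq => //; apply/fB; rewrite /x_ nth_index ?mem_enum // repE.
apply: inj_card_eq => n k /set_mem /= nA /set_mem /= kA.
move=> /right_coset_eq -/(_ sB)/fB; rewrite !repE ?x_A // => /eqP.
by rewrite nth_uniq ?enum_uniq -?cardE // => /eqP.
Qed.

End CosetIndex.

Lemma entry_take p i j : 0 < j <= i -> entry (take i p) j = entry p j.
Proof. by move=> ji; rewrite /entry nth_take //; lia. Qed.

Lemma entry_drop p i j : 0 < j -> entry (drop i p) j = entry p (j + i).
Proof. by move=> j0; rewrite /entry nth_drop; congr nth; lia. Qed.

(** * Fibre products *)

Section Amalgam.
Context (p : seq nat) (e : nat) (ep : e.+2 <= size p).
Local Notation pL := (take e.+1 p).
Local Notation pR := (drop e p).
Context (G L R : groupType) (X : nat -> G) (Y : nat -> L) (Z : nat -> R).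
Context (oG : G -> bool) (oL : L -> bool) (oR : R -> bool).
Context (SG : string_group X (size p).+1 oG).
Context (SL : string_group Y (size pL).+1 oL).
Context (SR : string_group Z (size pR).+1 oR).
Context (lam : G -> L) (del : G -> R) (s : L -> G) (t : R -> G).
Local Open Scope group_scope.
Local Open Scope classical_set_scope.
Local Open Scope card_scope.
Context (lamM : group_morphism lam) (delM : group_morphism del).
Context (sM : group_morphism s) (tM : group_morphism t).
Context (lamX : forall k, lam (X k) = Y k) (delX : forall k, del (X k) = Z (k - e)).
Context (sY : forall k, k <= e.+2 -> s (Y k) = X k).
Context (tZ : forall k, 0 < k -> t (Z k) = X (k + e)).
(** With [e = i - 1], the generators of index [e.+1], [e.+2], [e.+3] are [x_(i-1)], [x_i],
    [x_(i+1)]. The alternatives in [wX] are the two shapes of [r_i], for [p_i] even and for [p_i]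
    odd. *)
Let w := X e.+2 * X e.+3 * X e.+2.
Context (wX : X e.+1 * w * X e.+1 = w \/ X e.+1 * w * X e.+1 = X e.+3 * w * X e.+3).

Let sizeL : size pL = e.+1. Proof. by rewrite size_takel //; lia. Qed.
Let sizeR : size pR = (size p - e)%N. Proof. by rewrite size_drop. Qed.

Let Y1 k : e.+2 < k -> Y k = 1.
Proof. by move=> ek; apply: (strX0 SL); rewrite sizeL; lia. Qed.

Let Z0 : Z 0 = 1. Proof. exact: (strX0 SR). Qed.

(* The normal closure of the generators above [e.+2]. *)
Let N : set G := generated
  ([set X k | k in [set k | e.+2 < k]] `|` [set X e.+2 * X k * X e.+2 | k in [set k | e.+2 < k]]).

Let sN : is_subgroup N. Proof. exact: generated_subgroup. Qed.
Let N1 : N 1. Proof. by case: sN. Qed.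
Let NM x y : N x -> N y -> N (x * y). Proof. by case: sN => _ + _; apply. Qed.
Let NX k : e.+2 < k -> N (X k).
Proof. by move=> ek; apply: generatedT; left; exists k. Qed.
Let NXX k : e.+2 < k -> N (X e.+2 * X k * X e.+2).
Proof. by move=> ek; apply: generatedT; right; exists k. Qed.

Let XK k g : g * X k * X k = g. Proof. exact: (genK SG k g). Qed.
Let XC j k : j.+1 < k -> X k * X j = X j * X k.
Proof. by move=> jk; rewrite (strXC SG jk). Qed.

(** Conjugation by [X j] is inner to [N] for [j > e.+2], swaps the two families of generators for
    [j = e.+2], and is trivial on them for [j <= e]. The case [j = e.+1] is the real one: only [w]
    fails to commute for free, and [wX] handles it. *)
Lemma amalgam_normal j x : N x -> N (X j * x * X j).
Proof.
move: x; apply: generated_min; first split=> [|x y Nx Ny|x Nx] /=.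
- by rewrite mulg1 (strXX SG).
- have -> : X j * (x * y) * X j = (X j * x * X j) * (X j * y * X j).
    by rewrite !mulgA XK.
  exact: NM.
- have -> : X j * x^-1 * X j = (X j * x * X j)^-1 by rewrite !invgM !(genV SG) mulgA.
  by case: sN => _ _; apply.
move=> x xN /=; case: (ltngtP j e.+2) => [|je|->]; last first.
- case: xN => -[k /= ek <-]; first exact: NXX.
  by rewrite !mulgA XK (strXX SG) mul1g; apply: NX.
- have Nx : N x by apply: generatedT.
  by apply: NM; [apply: NM|] => //; apply: NX.
rewrite ltnS leq_eqVlt => /predU1P[->|je].
  case: xN => -[k /= ek <-]; first by rewrite -(XC ek) XK; apply: NX.
  move: ek; rewrite leq_eqVlt => /predU1P[<-|ek].
    rewrite -/w; case: wX => ->; first exact: NXX.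
    by apply: NM; [apply: NM|]; [exact: NX|exact: NXX|exact: NX].
  have ek1 : e.+2 < k by lia.
  by rewrite -(XC ek) XK -(XC ek1) XK; apply: NX; lia.
have je2 : j.+1 < e.+2 by lia.
have jk k : e.+2 < k -> j.+1 < k by lia.
case: xN => -[k /= ek <-]; first by rewrite -(XC (jk k ek)) XK; apply: NX.
have -> : X j * (X e.+2 * X k * X e.+2) * X j = X e.+2 * X k * X e.+2.
  rewrite !mulgA -(XC je2) -(mulgA (X e.+2)) -(XC (jk k ek)) !mulgA.
  by rewrite -(mulgA _ (X j)) -(XC je2) mulgA XK.
exact: NXX.
Qed.

Lemma amalgam_section g : N ((s (lam g))^-1 * g).
Proof.
apply: (par_indr SG (Q := fun g => N ((s (lam g))^-1 * g))) (strT SG g).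
  by rewrite (morphism1 lamM) (morphism1 sM) mulg1 invg1.
move=> k h _ Nh; rewrite lamM lamX sM; case: (leqP k e.+2) => ke.
  by rewrite sY // invgM (genV SG); have := amalgam_normal k Nh; rewrite !mulgA.
by rewrite Y1 // (morphism1 sM) mulg1 mulgA; apply: NM => //; apply: NX.
Qed.

(** [N] is generated by words in the [X k] with [k >= e.+2], and [t] after [del] fixes each [X k]
    with [k > e]. *)
Lemma amalgam_tdel x : N x -> t (del x) = x.
Proof.
have tdX k : e < k -> t (del (X k)) = X k.
  by move=> ek; rewrite delX tZ ?subnK //; lia.
move: x; apply: generated_min; first split=> [|x y /= xE yE|x /= xE] /=.
- by rewrite (morphism1 delM) (morphism1 tM).
- by rewrite delM tM xE yE.
- by rewrite (morphismV delM) (morphismV tM) xE.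
by move=> _ [|] [k /= ek <-]; rewrite ?delM ?tM !tdX //; lia.
Qed.

Lemma amalgam_split g : g = s (lam g) * t (del ((s (lam g))^-1 * g)).
Proof. by rewrite amalgam_tdel ?mulVKg //; apply: amalgam_section. Qed.

Lemma amalgam_ker g : lam g = 1 -> g = t (del g).
Proof. by move=> g1; rewrite {1}[g]amalgam_split g1 (morphism1 sM) mul1g invg1 mul1g. Qed.

Lemma lam_s : cancel s lam.
Proof.
apply: (morphism_ext SL) => [x y|//|k]; first by rewrite sM lamM.
case: (leqP k e.+2) => ke; first by rewrite sY // lamX.
by rewrite Y1 // (morphism1 sM) (morphism1 lamM).
Qed.

Lemma del_t : cancel t del.
Proof.
apply: (morphism_ext SR) => [x y|//|[|k]]; first by rewrite tM delM.
  by rewrite Z0 (morphism1 tM) (morphism1 delM).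
by rewrite tZ // delX addnK.
Qed.

Lemma lam_fix r g : fix_par X r g -> fix_par Y r (lam g).
Proof.
by apply: (morphism_par SG lamM) => k kr; rewrite lamX; apply: par_gen.
Qed.

Lemma lam_stab g : base_stab X g -> base_stab Y (lam g).
Proof. by move=> Bg r; apply: lam_fix. Qed.

Lemma del_fix r g : 0 < r -> fix_par X (r + e) g -> fix_par Z r (del g).
Proof.
by move=> r0; apply: (morphism_par SG delM) => k kr; rewrite delX; apply: par_gen; lia.
Qed.

Lemma del_stab g : base_stab X g -> base_stab Z (del g).
Proof.
move=> Bg [|r]; first exact: (fix_par_out SR).
exact: del_fix.
Qed.

Lemma s_par S g : par Y S g -> par X S (s g).
Proof.
apply: (morphism_par SL sM) => k Sk; case: (leqP k e.+2) => ke.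
  by rewrite sY //; apply: par_gen.
by rewrite Y1 // (morphism1 sM); apply: par1.
Qed.

Lemma s_stab g : base_stab Y g -> base_stab X (s g).
Proof. by move=> Bg r; apply: s_par (Bg r). Qed.

Lemma t_par (S T : nat -> bool) g : (forall k, 0 < k -> S k -> T (k + e)) ->
  par Z S g -> par X T (t g).
Proof.
move=> ST; apply: (morphism_par SR tM) => -[|k] Sk.
  by rewrite Z0 (morphism1 tM); apply: par1.
by rewrite tZ //; apply: par_gen; apply: ST.
Qed.

Lemma t_stab g : base_stab Z g -> base_stab X (t g).
Proof. by move=> Bg r; apply: t_par (Bg (r - e)%N) => k k0; lia. Qed.

Lemma odd_s g : oG (s g) = oL g.
Proof.
apply: (par_indl SL (Q := fun g => oG (s g) = oL g)) (strT SL g).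
  by rewrite (morphism1 sM) (str1 SG) (str1 SL).
move=> k h _ IH; rewrite sM (strM SG) (strM SL) IH; congr (_ (+) _).
case: (boolP (0 < k <= (size pL).+1)) => km; last first.
  by rewrite (strX0 SL km) (morphism1 sM) (str1 SG) (str1 SL).
rewrite (strX SL km) sY ?(strX SG) //; rewrite sizeL in km; lia.
Qed.

Lemma odd_t g : oG (t g) = oR g.
Proof.
apply: (par_indl SR (Q := fun g => oG (t g) = oR g)) (strT SR g).
  by rewrite (morphism1 tM) (str1 SG) (str1 SR).
move=> k h _ IH; rewrite tM (strM SG) (strM SR) IH; congr (_ (+) _).
case: (boolP (0 < k <= (size pR).+1)) => km; last first.
  by rewrite (strX0 SR km) (morphism1 tM) (str1 SG) (str1 SR).
rewrite (strX SR km) tZ ?(strX SG) //; rewrite sizeR in km; lia.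
Qed.

Context (TL : tight_group pL Y oL) (TR : tight_group pR Z oR).
Context (q_gt1 : 1 < entry p e.+1).
Local Notation q := (entry p e.+1).

(** If [Z 1] and [Z 2] coincided, the first power of the shared rotation would be trivial, although
    its order modulo the stabilizer is a multiple of [q > 1]. *)
Lemma stab_edge_trivial x :
  par Z (fun k => k == 1%N) x -> par Z (fun k => k == 2) x -> x = 1.
Proof.
move=> /(par1_cases SR)[//|x1] /(par1_cases SR)[//|x2].
case: TR => _ _ /(_ 1%N 1%N) + _; rewrite sizeR entry_drop // add1n.
move=> /(_ _ _) H; have : q %| 1; last by rewrite dvdn1; lia.
apply: H => [|r]; first lia.
by rewrite expg1 -x2 x1 (strXX SR); apply: par1.
Qed.

Lemma del_s_par (S T : nat -> bool) x : (S e.+1 -> T 1%N) -> (S e.+2 -> T 2) ->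
  par Y S x -> par Z T (del (s x)).
Proof.
move=> ST1 ST2; apply: (morphism_par (f := fun x => del (s x)) SL).
  by move=> g h; rewrite sM delM.
move=> k Sk; case: (leqP k e.+2) => ke; last first.
  by rewrite Y1 // (morphism1 sM) (morphism1 delM); apply: par1.
rewrite sY // delX; move: ke; rewrite leq_eqVlt => /predU1P[ke|].
  by rewrite ke subSn ?subSnn //; apply: par_gen; apply: ST2; rewrite -ke.
rewrite ltnS leq_eqVlt => /predU1P[ke|ke].
  by rewrite ke subSnn; apply: par_gen; apply: ST1; rewrite -ke.
by have -> : (k - e = 0)%N by [lia]; rewrite Z0; apply: par1.
Qed.

(** Flag stabilizers vanish in the shared dihedral group: a word avoiding [Y e.+2] maps into the
    subgroup of [Z 1], one avoiding [Y e.+1] into that of [Z 2], and these meet trivially. This lets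
    stabilizers be compared factor by factor. *)
Lemma del_s_stab b : base_stab Y b -> del (s b) = 1.
Proof.
move=> Bb; apply: stab_edge_trivial.
  by apply: del_s_par (Bb e.+2) => //; lia.
by apply: del_s_par (Bb e.+1) => //; lia.
Qed.

Lemma amalgam_stab g : base_stab Y (lam g) -> base_stab Z (del g) -> base_stab X g.
Proof.
move=> BL BR; rewrite [g]amalgam_split delM (morphismV delM) del_s_stab // invg1 mul1g.
have [_ BM _] := base_stab_subgroup X.
by apply: BM; [apply: s_stab|apply: t_stab].
Qed.

(** The factors of [lam g] are stripped from both sides of [g], which leaves an element of the
    kernel of [lam], hence in the image of [t]. Its own factors then sit next to the right outer
    ones: stabilizer on the left, interval on the right. *)
Lemma amalgam_interval : interval_generated X.
Proof.
case: TL TR => CL _ _ _ [CR _ _ _] a b g fg.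
have [|u [v [Bu Sv euv]]] := CL a b (lam g).
  by move=> r rab; apply: lam_fix (fg r rab).
pose g' := (s u)^-1 * g * (s v)^-1.
have fg' r : ~~ (a < r < b) -> fix_par X r g'.
  move=> rab; apply: parF; last by apply: par_itv_fix (s_par Sv) _.
  apply: parM; last exact: fg.
  by apply: parV; apply: s_stab.
have g'E : g' = t (del g').
  by apply: amalgam_ker; rewrite /g' !lamM !(morphismV lamM) !lam_s euv mulKg mulgV.
(* Truncation at 0 is harmless: [Z 0] is 1, so index 0 imposes no condition in [R]. *)
have [|u' [v' [Bu' Sv' euv']]] := CR (a - e)%N (b - e)%N (del g').
  move=> [|r] rab; first exact: (fix_par_out SR).
  by apply: del_fix => //; apply: fg'; lia.
exists (s u * t u'), (t v' * s v); split.
- by have [_ BM _] := base_stab_subgroup X; apply: BM; [apply: s_stab|apply: t_stab].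
- apply: parM; last exact: s_par.
  by apply: t_par Sv' => k k0; lia.
- have -> : g = s u * g' * s v by rewrite /g' !mulgA mulgVK mulgV mul1g.
  by rewrite g'E euv' tM !mulgA.
Qed.

Lemma amalgam_even b : base_stab X b -> ~~ oG b.
Proof.
case: TL TR => _ _ _ EL [_ _ _ ER] Bb.
rewrite [b]amalgam_split delM (morphismV delM) del_s_stab; last exact: lam_stab.
rewrite invg1 mul1g (strM SG) odd_s odd_t.
by rewrite (negbTE (EL _ (lam_stab Bb))) (negbTE (ER _ (del_stab Bb))).
Qed.

Lemma amalgam_rotation j n : 0 < j <= size p ->
  base_stab X ((X j * X j.+1) ^+ n) -> entry p j %| n.
Proof.
case: TL TR => _ _ RL _ [_ _ RR _] jm; case: (leqP j e.+1) => je.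
  move=> /lam_stab; rewrite (morphismX lamM) lamM !lamX => /RL.
  by rewrite entry_take ?sizeL; [apply; lia|lia].
move=> /del_stab; rewrite (morphismX delM) delM !delX subSn; last lia.
by move=> /RR; rewrite sizeR entry_drop ?subnK; [apply; lia|lia|lia].
Qed.

(* The retraction of [R] onto the dihedral subgroup that it shares with [L]. *)
Let phi x := del (s (lam (t x))).

Let phiM : group_morphism phi.
Proof. by move=> x y; rewrite /phi tM lamM sM delM. Qed.

Lemma phi_Z k : phi (Z k) = if k <= 2 then Z k else 1.
Proof.
case: k => [|k].
  by rewrite Z0 (morphism1 phiM).
rewrite /phi tZ // lamX; case: (leqP k.+1 2) => k2.
  by rewrite sY ?delX ?addnK //; lia.
by rewrite Y1 ?(morphism1 sM) ?(morphism1 delM) //; lia.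
Qed.

Lemma phi_dihedral x : par Z (fun k => 0 < k < 3) (phi x).
Proof.
apply: (morphism_par SR phiM) (strT SR x) => k _; rewrite phi_Z.
case: ifP => k2; last exact: par1.
by case: k k2 => [|k] k2; [rewrite Z0; apply: par1|apply: par_gen].
Qed.

Lemma phi_id x : par Z (fun k => 0 < k < 3) x -> phi x = x.
Proof.
apply: (par_indl SR (Q := fun x => phi x = x)); first exact: morphism1.
by move=> k h kk IH; rewrite phiM IH phi_Z ifT //; lia.
Qed.

Lemma phi_stab x : base_stab Z x -> phi x = 1.
Proof.
have H k (T : nat -> bool) : (forall l, l != k -> 0 < l < 3 -> T l) ->
    fix_par Z k x -> par Z T (phi x).
  move=> HT; apply: (morphism_par SR phiM) => l lk; rewrite phi_Z.
  case: ifP => l2; last exact: par1.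
  case: l l2 lk => [|l] l2 lk; first by rewrite Z0; apply: par1.
  by apply: par_gen; apply: HT.
by move=> Bx; apply: stab_edge_trivial; [apply: H (Bx 2)|apply: H (Bx 1%N)]; lia.
Qed.

Lemma phi_del g : phi (del g) = del (s (lam g)).
Proof.
apply: (morphism_ext SG (f1 := fun g => phi (del g)) (f2 := fun g => del (s (lam g))))
  => [x y|x y|k].
- by rewrite delM phiM.
- by rewrite lamM sM delM.
rewrite delX lamX phi_Z; case: ifP => k2; first by rewrite sY ?delX //; lia.
by rewrite Y1 ?(morphism1 sM) ?(morphism1 delM) //; lia.
Qed.

(** Both [phi] and [lam] after [t] kill [Z k] for [k > 2]; hence an element killed by [phi] is sent
    by [t] into the kernel of [lam]. *)
Lemma lam_t_phi x : lam (t (phi x)) = lam (t x).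
Proof.
apply: (morphism_ext SR (f1 := fun x => lam (t (phi x))) (f2 := fun x => lam (t x)))
  => [x' y|x' y|k].
- by rewrite phiM tM lamM.
- by rewrite tM lamM.
rewrite phi_Z; case: ifP => k2 //.
rewrite (morphism1 tM) (morphism1 lamM) tZ ?lamX ?Y1 //; lia.
Qed.

Local Notation qR := (entry pR 1).
Context (rotZ : (Z 1%N * Z 2) ^+ qR = 1).

Let dihedral (a : 'I_qR * bool) : R :=
  (if a.2 then Z 1%N else 1) * (Z 1%N * Z 2) ^- a.1.

Let size_pR : 0 < 1 <= size pR. Proof. by rewrite sizeR; lia. Qed.
Let qR_gt0 : 0 < qR. Proof. by rewrite entry_drop // add1n; apply: ltnW. Qed.

(** Parity separates reflections from rotations, and [TR] gives the rotation its full order. *)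
Lemma dihedral_inj : injective dihedral.
Proof.
have oD a : oR (dihedral a) = a.2.
  rewrite (strM SR) (strV SR) (odd_rotation SR size_pR) addbF.
  by case: ifP => _; [apply: (strX SR)|apply: (str1 SR)].
move=> [i b] [j c] E; have /= bc : (i, b).2 = (j, c).2 by rewrite -!oD E.
rewrite {}bc in E *; congr (_, _); move: E => /mulgI/invg_inj /=.
wlog ij : i j / i <= j => [H E|].
  by case/orP: (leq_total i j) => ij; [apply: H|apply/esym/H].
rewrite -(subnKC ij) expgnDr -{1}[_ ^+ i]mulg1 => /mulgI /esym E.
have : qR %| j - i.
  by case: TR => _ _ + _; apply=> // r; rewrite E; apply: par1.
have ltj := ltn_ord j; case: (posnP (j - i)) => [ji _|ji /(dvdn_leq ji)]; last lia.
by apply: val_inj; rewrite /=; lia.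
Qed.

Lemma dihedral_onto x : par Z (fun k => 0 < k < 3) x -> exists a, dihedral a = x.
Proof.
move=> /(dihedral_par SR size_pR rotZ qR_gt0)[n E].
rewrite (rotation_mod rotZ) in E; pose i := Ordinal (ltn_pmod n qR_gt0).
case: E => ->; [exists (i, false)|exists (i, true)] => //.
exact: mul1g.
Qed.

Lemma prod_take_drop :
  (\prod_(k <- pL) k * \prod_(k <- pR) k = \prod_(k <- p) k * q)%N.
Proof.
have eP : e < size p by lia.
rewrite (take_nth 0 eP) -cats1 -[in RHS](cat_take_drop e p) !big_cat big_seq1 /=.
by rewrite cat_take_drop -!mulnA; congr (_ * _)%N; rewrite mulnC.
Qed.

(* On cosets of the flag stabilizers, (g, d) |-> (lam g, del g * d) is a
   bijection from G times the dihedral group of order 2 q onto L times R. *)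
Lemma amalgam_card :
  right_cosets (base_stab X) #= `I_(2 * \prod_(k <- p) k).
Proof.
case: TL TR => _ cL _ _ [_ cR _ _].
have sBX := base_stab_subgroup X; have sBY := base_stab_subgroup Y.
have sBZ := base_stab_subgroup Z.
have [fL [fLB fLs]] := coset_index sBY cL; have [fR [fRB fRs]] := coset_index sBZ cR.
pose f g := (fL (lam g), fR (del g)).
have fB g h : f g = f h <-> base_stab X (g * h^-1).
  split=> [[/fLB BL /fRB BR]|B].
    by apply: amalgam_stab; rewrite ?lamM ?delM ?(morphismV lamM) ?(morphismV delM).
  congr (_, _); [apply/fLB|apply/fRB].
    by have := lam_stab B; rewrite lamM (morphismV lamM).
  by have := del_stab B; rewrite delM (morphismV delM).
pose A := [set x | `[< exists g, f g = x >]]%SET.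
have fA x : (x \in A) <-> exists g, f g = x by rewrite finset.inE; split=> /asboolP.
suff <- : #|A| = (2 * \prod_(k <- p) k)%N by apply: card_coset_index fB fA.
have fRM x y z : fR x = fR y -> fR (x * z) = fR (y * z).
  by move=> /fRB B; apply/fRB; rewrite mulgKA.
have /choice[rep repE] := fRs.
pose F (x : 'I_(2 * \prod_(k <- pL) k) * 'I_(2 * \prod_(k <- pR) k) * ('I_qR * bool)) :=
  (x.1.1, fR (rep x.1.2 * dihedral x.2)).
have FE g D : F (f g, D) = (fL (lam g), fR (del g * dihedral D)).
  by congr (_, _); apply: fRM; rewrite repE.
have phiD D : phi (dihedral D) = dihedral D.
  apply: phi_id; rewrite /dihedral; apply: parM.
    by case: ifP => _; [apply: par_gen|apply: par1].
  apply: parV; elim: (nat_of_ord _) => [|n IH]; first exact: par1.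
  by rewrite expgS; apply: parM => //; apply: parM; apply: par_gen.
have Finj : {in finset.setX A [set: _]%SET &, injective F}.
  move=> [x D] [x' D'] /finset.setXP[/fA[g <-] _] /finset.setXP[/fA[g' <-] _].
  rewrite !FE => -[/fLB BL /fRB BR].
  have del_eq : del (s (lam g)) = del (s (lam g')).
    apply: divg1_eq; rewrite -(morphismV delM) -(morphismV sM) -(morphismV lamM).
    rewrite -delM -sM -lamM; apply: del_s_stab.
    by rewrite lamM (morphismV lamM).
  (* Applying [phi] kills the stabilizer and replaces [del g], [del g'] by [del (s (lam g))],
     [del (s (lam g'))], which agree by [del_eq]; what remains compares [D] with [D']. *)
  have DD : D = D'.
    apply: dihedral_inj; have := phi_stab BR.
    rewrite (phiM (_ * _)) (morphismV phiM) (phiM (del g)) (phiM (del g')) !phiD !phi_del del_eq.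
    by move=> /divg1_eq /mulgI.
  rewrite {}DD in BR *; congr (_, _); apply/fB; apply: amalgam_stab.
    by rewrite lamM (morphismV lamM).
  by move: BR; rewrite mulgKA delM (morphismV delM).
have Fonto : F @: finset.setX A [set: _]%SET = [set: _]%SET.
  apply/setP => -[u v]; rewrite finset.inE; apply/imsetP.
  have [a <-] := fLs u; have [b <-] := fRs v.
  have dsa : par Z (fun k => 0 < k < 3) (del (s a)).
    by apply: del_s_par (strT SL a).
  (* Solve for [g = s a * t k]. For [lam g = a] the element [k] must be killed by [phi], and for
     [del g * dihedral D = b] it must be the [k] below; the two demands force this [D]. *)
  have [|D DE] := @dihedral_onto ((del (s a))^-1 * phi b).
    by apply: parM; [apply: parV|apply: phi_dihedral].
  pose k := (del (s a))^-1 * b * (dihedral D)^-1.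
  have phik : phi k = 1.
    rewrite /k !phiM !(morphismV phiM) phiD phi_id // DE.
    by rewrite mulgV.
  have lamtk : lam (t k) = 1.
    by rewrite -lam_t_phi phik (morphism1 tM) (morphism1 lamM).
  exists (f (s a * t k), D).
    by apply/finset.setXP; split; [apply/fA; eexists|rewrite finset.inE].
  rewrite FE lamM lam_s lamtk mulg1 delM del_t /k; congr (_, fR _).
  by move: (dihedral D) => d; rewrite !mulgA mulgV mul1g mulgVK.
have := card_in_imset Finj; rewrite Fonto cardsX !cardsT !card_prod !card_ord card_bool.
rewrite entry_drop // add1n => E.
have q0 : 0 < q * 2 by lia.
by apply/eqP; rewrite -(eqn_pmul2r q0) -E -mulnACA prod_take_drop; apply/eqP; lia.
Qed.

Lemma amalgam_tight_group : tight_group p X oG.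
Proof.
split; [exact: amalgam_interval|exact: amalgam_card|exact: amalgam_rotation|exact: amalgam_even].
Qed.

End Amalgam.


(** * Inclusions and retractions of the presented groups *)

Lemma expg_even (G : groupType) (x : G) n : (x * x = 1)%g -> ~~ odd n -> (x ^+ n = 1)%g.
Proof.
move=> xx n_even; rewrite -(even_halfK n_even) -muln2 mulnC expgnA expg2 xx.
exact: expg1n.
Qed.

Lemma invol_conj_sq (G : groupType) (a b : G) :
  (a * a = 1 -> b * b = 1 -> (a * (b * a)) ^+ 2 = 1)%g.
Proof.
by move=> aa bb; rewrite expg2 !mulgA -(mulgA _ a a) aa mulg1 -(mulgA a b b) bb mulg1.
Qed.

(** The product [a * w * c] is an involution or 1, hence equals its inverse [c * w * a]; then move
    [c] across and use that it commutes with [a]. *)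
Lemma invol_swap (G : groupType) (a w c : G) :
  (a * a = 1 -> w * w = 1 -> c * c = 1 -> a * c = c * a ->
   (a * (w * c)) ^+ 2 = 1 -> a * w * a = c * w * c)%g.
Proof.
move=> aa ww cc ac; rewrite expg2 => /mulg1_eq.
have invE (x : G) : (x * x = 1 -> x^-1 = x)%g by exact: mulg1_eq.
rewrite !invgM !invE // mulgA => E.
by rewrite -[(a * w)%g in LHS]mulg1 -cc !mulgA -E -(mulgA _ a c) ac
  !mulgA -(mulgA _ a a) aa mulg1.
Qed.

Section Retractions.
Context (p : seq nat) (e : nat) (ep : e.+2 <= size p).
Context (even1 : ~~ odd (entry p e)) (even2 : ~~ odd (entry p e.+2)).
Local Notation pL := (take e.+1 p).
Local Notation pR := (drop e p).
Local Open Scope group_scope.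
Local Notation X := (genX p).
Local Notation Y := (genX pL).
Local Notation Z := (genX pR).

Let sizeL : size pL = e.+1. Proof. by rewrite size_takel //; lia. Qed.
Let sizeR : size pR = (size p - e)%N. Proof. by rewrite size_drop. Qed.

Let YY k : Y k * Y k = 1. Proof. exact: (strXX (Gamma_string_group pL)). Qed.
Let ZZ k : Z k * Z k = 1. Proof. exact: (strXX (Gamma_string_group pR)). Qed.
Let Y1 k : e.+2 < k -> Y k = 1.
Proof. by move=> ek; apply: (strX0 (Gamma_string_group pL)); rewrite sizeL; lia. Qed.
Let Z0 k : k <= 0 -> Z k = 1.
Proof. by move=> ek; apply: (strX0 (Gamma_string_group pR)); lia. Qed.

Lemma left_inclusion_spec : Gamma_spec pL X.
Proof.
have XS := genX_spec p; have el := @entry_take p e.+1.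
split; rewrite ?sizeL => j *.
- by apply: (spec_inv XS); lia.
- by rewrite el //; apply: (spec_rot XS); lia.
- by apply: (spec_comm XS) => //; lia.
- by apply: (spec_ee XS) => //; rewrite -?el //; lia.
- by apply: (spec_oe XS) => //; rewrite -?el //; lia.
- by apply: (spec_eo XS) => //; rewrite -?el //; lia.
Qed.

Lemma right_inclusion_spec : Gamma_spec pR (fun k => X (k + e)).
Proof.
have XS := genX_spec p; have er := @entry_drop p e.
split; rewrite ?sizeR => j *; rewrite !addSn.
- by apply: (spec_inv XS); lia.
- by rewrite er; [apply: (spec_rot XS)|]; lia.
- by apply: (spec_comm XS) => //; lia.
- by apply: (spec_ee XS) => //; rewrite -?addSn -?er //; lia.
- by apply: (spec_oe XS) => //; rewrite -?addSn -?er //; lia.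
- by apply: (spec_eo XS) => //; rewrite -?addSn -?er //; lia.
Qed.

(** Only boundary relators need care. The rotation relator for [entry p e.+2] becomes an even power
    of an involution. The even-odd relator at [j = e.+1] would become the fourth power of
    [Y e.+2 * Y e.+1], not trivial in general; [even2] rules it out. *)
Lemma left_retraction_spec : Gamma_spec p Y.
Proof.
have YS := genX_spec pL; have el := @entry_take p e.+1.
split=> [j jm|j jm|j k jm km jk|j j0 jm o1 o2|j j0 jm o1 o2|j j0 jm o1 o2].
- exact: YY.
- case: (ltngtP j e.+2) => je.
  + by rewrite -el; [apply: (spec_rot YS); rewrite sizeL|]; lia.
  + by rewrite !Y1 ?mulg1 ?expg1n //; lia.
  + by rewrite je (Y1 (ltnSn _)) mulg1; apply: expg_even.
- case: (leqP j e.+1) => je; last by rewrite (@Y1 j.+1) // mul1g; exact: YY.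
  case: (leqP k e.+1) => ke; last by rewrite (@Y1 k.+1) // mulg1; exact: YY.
  by apply: (spec_comm YS); rewrite ?sizeL.
- case: (ltngtP j e.+1) => je.
  + by apply: (spec_ee YS); rewrite ?sizeL ?el //; lia.
  + by rewrite (@Y1 j.+1) ?(@Y1 j.+2) ?mulg1 ?expg2 ?YY //; lia.
  + by rewrite je (@Y1 e.+3) // mul1g YY mulg1 expg2 YY.
- case: (ltngtP j e.+1) => je.
  + by apply: (spec_oe YS); rewrite ?sizeL ?el //; lia.
  + by rewrite (@Y1 j.+1) ?(@Y1 j.+2) ?mulg1 ?expg2 ?YY //; lia.
  + by rewrite je (@Y1 e.+3) // mul1g mulg1 YY mulg1 expg2 YY.
- case: (ltngtP j e.+1) => je.
  + by apply: (spec_eo YS); rewrite ?sizeL ?el //; lia.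
  + by rewrite (@Y1 j.+1) ?(@Y1 j.+2) ?mul1g ?YY ?expg1n //; lia.
  + by move: o2; rewrite je (negbTE even2).
Qed.

(** The mirror image: [k - e] truncates to 0 for [k <= e], so these generators die. At [j = e] the
    odd-even relator would leave the fourth power of [Z 1 * Z 2]; [even1] rules it out. *)
Lemma right_retraction_spec : Gamma_spec p (fun k => Z (k - e)).
Proof.
have ZS := genX_spec pR; have er := @entry_drop p e.
split=> [j jm|j jm|j k jm km jk|j j0 jm o1 o2|j j0 jm o1 o2|j j0 jm o1 o2].
- exact: ZZ.
- case: (ltngtP j e) => je.
  + by rewrite !Z0 ?mulg1 ?expg1n //; lia.
  + rewrite subSn; last lia.
    have -> : entry p j = entry pR (j - e) by rewrite er ?subnK //; lia.
    by apply: (spec_rot ZS); rewrite sizeR; lia.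
  + by rewrite je (@Z0 (e - e)) ?subnn // mul1g; apply: expg_even => //; exact: ZZ.
- case: (leqP e j) => je; last by rewrite (@Z0 (j.+1 - e)) ?mul1g; [exact: ZZ|lia].
  case: (leqP e k) => ke; last by rewrite (@Z0 (k.+1 - e)) ?mulg1; [exact: ZZ|lia].
  by rewrite !subSn //; apply: (spec_comm ZS); rewrite ?sizeR; lia.
- case: (ltngtP j e) => je.
  + by rewrite (@Z0 (j - e)) ?(@Z0 (j.+1 - e)) ?mul1g ?mulg1 ?expg2 ?ZZ //; lia.
  + have ej := ltnW je; rewrite !subSn ?leqW //.
    by apply: (spec_ee ZS); rewrite ?sizeR ?er ?addSn ?subnK //; lia.
  + rewrite je (@Z0 (e - e)) ?subnn // mul1g; apply: invol_conj_sq; exact: ZZ.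
- case: (ltngtP j e) => je.
  + by rewrite (@Z0 (j - e)) ?(@Z0 (j.+1 - e)) ?mul1g ?ZZ ?expg1n //; lia.
  + have ej := ltnW je; rewrite !subSn ?leqW //.
    by apply: (spec_oe ZS); rewrite ?sizeR ?er ?addSn ?subnK //; lia.
  + by move: o1; rewrite je (negbTE even1).
- case: (ltngtP j e) => je.
  + by rewrite (@Z0 (j - e)) ?(@Z0 (j.+1 - e)) ?mul1g ?mulg1 ?expg2 ?ZZ //; lia.
  + have ej := ltnW je; rewrite !subSn ?leqW //.
    by apply: (spec_eo ZS); rewrite ?sizeR ?er ?addSn ?subnK //; lia.
  + by rewrite je (@Z0 (e - e)) ?subnn // mulg1 mul1g ZZ mulg1 expg2 ZZ.
Qed.

Lemma shared_edge_relation :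
  let w := X e.+2 * X e.+3 * X e.+2 in
  X e.+1 * w * X e.+1 = w \/ X e.+1 * w * X e.+1 = X e.+3 * w * X e.+3.
Proof.
have XS := genX_spec p; have SG := Gamma_string_group p => w.
have XX k : X k * X k = 1 := strXX SG k.
have ww : w * w = 1 by rewrite /w !mulgA !(genK SG) XX.
case o : (odd (entry p e.+1)); [right|left].
  apply: invol_swap => //; first exact: (strXC SG).
  by have := spec_oe XS (ltn0Sn e) ep o even2; rewrite /w !mulgA.
(* The even case is [invol_swap] with [c = 1]. *)
rewrite -[RHS]mul1g -[RHS]mulg1; apply: invol_swap => //; rewrite ?mulg1 ?mul1g //.
by have := spec_ee XS (ltn0Sn e) ep (negbT o) even2; rewrite /w !mulgA.
Qed.

Lemma Gamma_amalgam (e_gt0 : 0 < e) (q_gt1 : 1 < entry p e.+1) :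
  tight_group pL Y (@odd_elt pL) -> tight_group pR Z (@odd_elt pR) ->
  tight_group p X (@odd_elt p).
Proof.
move=> TL TR.
have SG := Gamma_string_group p; have SL := Gamma_string_group pL.
have SR := Gamma_string_group pR.
have [lam [lamM lamX]] := Gamma_lift left_retraction_spec.
have [del [delM delX]] := Gamma_lift right_retraction_spec.
have [s [sM sX]] := Gamma_lift left_inclusion_spec.
have [t [tM tX]] := Gamma_lift right_inclusion_spec.
rewrite sizeL in sX; rewrite sizeR in tX.
have outX := strX0 SG.
apply: (@amalgam_tight_group _ _ ep _ _ _ _ _ _ _ _ _ SG SL SR lam del s t) => //.
- move=> k; case: (boolP (0 < k <= (size p).+1)) => km; first exact: lamX.
  rewrite outX // (morphism1 lamM) (strX0 SL) // sizeL; lia.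
- move=> k; case: (boolP (0 < k <= (size p).+1)) => km; first exact: delX.
  rewrite outX // (morphism1 delM) (strX0 SR) // sizeR; lia.
- move=> k ke; case: (posnP k) => k0; last by apply: sX; lia.
  by rewrite k0 (strX0 SL) // (morphism1 sM) outX.
- move=> k k0; case: (leqP k (size p - e).+1) => km; first by apply: tX; lia.
  rewrite (strX0 SR) ?(morphism1 tM) ?outX // ?sizeR; lia.
- exact: shared_edge_relation.
- by apply: (spec_rot (genX_spec pR)); rewrite sizeR; lia.
Qed.

End Retractions.

Lemma Gamma_tightP (p : seq nat) : (forall j, 0 < j <= size p -> 0 < entry p j) ->
  tight_orientably_regular_polytope (coset_poset p) p <->
  tight_group p (genX p) (@odd_elt p).
Proof.
move=> p_gt0; apply: (tight_group_polytopeP (Gamma_string_group p) (Gamma_geometry p)) => //.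
exact: spec_rot (genX_spec p).
Qed.

(* take i p = (p_1, ..., p_i) and drop i.-1 p = (p_i, ..., p_(n-1)). *)
Theorem theorem4p7 (n : nat) (p : n.-1.-tuple nat) (i : nat)
  (hn : 4 <= n)
  (hp : admissible p)
  (hi : 2 <= i <= n - 2)
  (hprev : ~~ odd (entry p i.-1))
  (hnext : ~~ odd (entry p i.+1))
  (hleft : tight_orientably_regular_polytope
             (coset_poset (take i p)) (take i p))
  (hright : tight_orientably_regular_polytope
             (coset_poset (drop i.-1 p)) (drop i.-1 p)) :
  tight_orientably_regular_polytope (coset_poset p) p.
Proof.
have sizep : size p = n.-1 := size_tuple p.
case: i => [|e] // in hi hprev hnext hleft hright *; rewrite /= in hprev hright.
have ep : e.+2 <= size p by lia.
have [p_ge2 _] := hp.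
have p_gt0 j : 0 < j <= size p -> 0 < entry p j by move=> /p_ge2; lia.
apply/Gamma_tightP => //; apply: (Gamma_amalgam ep hprev hnext); first lia.
- by apply: p_ge2; lia.
- apply/Gamma_tightP => // j; rewrite size_takel; last lia.
  by move=> jm; rewrite entry_take //; apply: p_gt0; lia.
- apply/Gamma_tightP => // j; rewrite size_drop => jm.
  by rewrite entry_drop; [apply: p_gt0|]; lia.
Qed.
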